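(* Let $p, d \in \mathbb{N}$ with $p \geq d$. For all $A, B \in M_{p,d}(\mathbb{C})$ and $\sigma, \rho \in \mathbb{R}$, $$\mu^\Box_{\mathrm{SPN}}(A,\sigma) = \mu^\Box_{\mathrm{SPN}}(B,\rho) \iff \left( \mu_{A^*A} = \mu_{B^*B} \ \text{ and } \ \sigma^2 = \rho^2 \right).$$
   Context: A C$^*$-probability space is a pair $(\mathfrak{A},\tau)$ of a unital C$^*$-algebra $\mathfrak{A}$ and a faithful tracial state $\tau$ on $\mathfrak{A}$. The distribution of a self-adjoint $a\in\mathfrak{A}$ is the compactly supported probability measure $\mu_a$ on $\mathbb{R}$ with $\int x^k\,\mu_a(dx)=\tau(a^k)$ for all $k\in\mathbb{N}$. Freeness is in the sense of Voiculescu: a family of $*$-subalgebras $(\mathfrak{A}_j)_{j\in J}$ is free if $\tau(a_1\cdots a_n)=0$ whenever $a_l\in\mathfrak{A}_{j_l}$, $\tau(a_l)=0$, $j_1\neq j_2\neq\cdots\neq j_n$; a family of self-adjoint elements is free if the $*$-subalgebras of polynomials in them are free. A standard semicircular element is a self-adjoint element with distribution $\frac{\sqrt{4-x^2}}{2\pi}\mathbf{1}_{[-2,2]}(x)\,dx$. A circular element of variance $v>0$ is $c=\sqrt{v}\,(s_1+is_2)/\sqrt{2}$ with $s_1,s_2$ free standard semicircular elements. A $*$-free circular family is a family $(c_j)_{j}$ of circular elements such that the family of all $\mathrm{Re}\,c_j,\mathrm{Im}\,c_j$ is free. Let $(\mathfrak{A},\tau)$ be a C$^*$-probability space containing a $*$-free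 family $(C_{ij})_{1\le i\le p,1\le j\le d}$ of circular elements with $\tau(C_{ij})=0$ and $\tau(C_{ij}^*C_{ij})=1/d$, and let $C=(C_{ij})\in M_{p,d}(\mathfrak{A})$. For $A\in M_{p,d}(\mathbb{C})$ and $\sigma\in\mathbb{R}$ put $W^\Box_{\mathrm{SPN}}(A,\sigma)=(A+\sigma C)^*(A+\sigma C)\in M_d(\mathfrak{A})$, and let $\mu^\Box_{\mathrm{SPN}}(A,\sigma)$ be the distribution of $W^\Box_{\mathrm{SPN}}(A,\sigma)$ in the C$^*$-probability space $(M_d(\mathfrak{A}),\mathrm{tr}_d\otimes\tau)$, where $(\mathrm{tr}_d\otimes\tau)(X)=\frac1d\sum_{i=1}^d\tau(X_{ii})$. For a self-adjoint matrix $W\in M_d(\mathbb{C})$ with eigenvalues $\lambda_1\le\dots\le\lambda_d$ (with multiplicity), $\mu_W=\frac1d\sum_{k=1}^d\delta_{\lambda_k}$. *)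

(* Defs.v *)
From HB Require Import structures.
From mathcomp Require Import all_boot all_order all_algebra.
From mathcomp Require Import complex.
From mathcomp Require Import all_classical all_reals all_analysis.

Set Implicit Arguments.
Unset Strict Implicit.
Unset Printing Implicit Defensive.

Import Order.TTheory GRing.Theory Num.Theory.
Import numFieldNormedType.Exports.

Local Open Scope classical_set_scope.
Local Open Scope ring_scope.
Local Open Scope complex_scope.

(* The norm is part of this mixin rather than inherited from normedModType,
   because Hierarchy Builder rejects a join of pzRingType and normedZmodType
   other than numDomainType. *)
HB.mixin Record Algebra_isCStarAlgebra (R : realType) A
    of GRing.Algebra R[i] A := {
  star : A -> A ;
  starK : involutive star ;
  starD : {morph star : x y / x + y} ;
  starZ : forall (z : R[i]) (x : A), star (z *: x) = (z^*)%C *: star x ;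
  starM : forall x y : A, star (x * y) = star y * star x ;
  cnorm : A -> R ;
  cnorm0_eq0 : forall x : A, cnorm x = 0 -> x = 0 ;
  cnormD : forall x y : A, cnorm (x + y) <= cnorm x + cnorm y ;
  cnormZ : forall (z : R[i]) (x : A),
    cnorm (z *: x) = complex.Re `|z| * cnorm x ;
  cnormM : forall x y : A, cnorm (x * y) <= cnorm x * cnorm y ;
  cnorm_star : forall x : A, cnorm (star x * x) = cnorm x ^+ 2 ;
  cnorm_complete : forall u : nat -> A,
    (forall e : R, 0 < e -> exists N : nat, forall m n : nat,
      (N <= m)%N -> (N <= n)%N -> cnorm (u m - u n) < e) ->
    exists l : A, cnorm (u n - l) @[n --> \oo] --> (0 : R)
}.

#[short(type="cstarAlgType")]
HB.structure Definition CStarAlgebra (R : realType) :=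
  {A of GRing.Algebra R[i] A & Algebra_isCStarAlgebra R A}.

Record faithful_tracial_state (R : realType) (A : cstarAlgType R)
    (tau : {scalar A}) : Prop := FaithfulTracialState {
  state1 : tau 1 = 1 ;
  state_ge0 : forall x : A, 0 <= tau (star x * x) ;
  state_faithful : forall x : A, tau (star x * x) = 0 -> x = 0 ;
  state_trace : forall x y : A, tau (x * y) = tau (y * x)
}.

(* The distribution involves only the powers of a and the functional, so it is
   stated for an arbitrary ring; it then applies both to a C*-algebra and to
   matrices over it. Because of the bounded support, the integral is finite. *)
Definition is_distribution (R : realType) (A : pzRingType) (tau : A -> R[i])
    (a : A) (mu : probability (measurableTypeR R) R) : Prop :=
  (exists M : R, mu (~` `[- M, M]) = 0%E) /\
  (forall k : nat, tau (a ^+ k) = (\int[mu]_x (x ^+ k))%:C).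

Definition self_adjoint (R : realType) (A : cstarAlgType R) (a : A) : Prop :=
  star a = a.

Definition free_sets (R : realType) (A : cstarAlgType R) (tau : A -> R[i])
    (J : Type) (S : J -> set A) : Prop :=
  forall (n : nat) (j : nat -> J) (a : nat -> A), (0 < n)%N ->
    (forall l, (l < n)%N -> S (j l) (a l) /\ tau (a l) = 0) ->
    (forall l, (l.+1 < n)%N -> j l <> j l.+1) ->
    tau (\prod_(0 <= l < n) a l) = 0.

(* For self-adjoint a this is a unital *-subalgebra. *)
Definition polynomials_in (R : realType) (A : cstarAlgType R) (a : A) : set A :=
  [set horner_alg a q | q in [set: {poly R[i]}]].

Definition free_family (R : realType) (A : cstarAlgType R) (tau : A -> R[i])
    (J : Type) (a : J -> A) : Prop :=
  free_sets tau (fun j => polynomials_in (a j)).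

Definition semicircle_density (R : realType) (x : R) : R :=
  Num.sqrt (4 - x ^+ 2) / (2 * pi) * \1_(`[- 2, 2] : set R) x.

Definition standard_semicircular (R : realType) (A : cstarAlgType R)
    (tau : A -> R[i]) (s : A) : Prop :=
  self_adjoint s /\
  exists mu : probability (measurableTypeR R) R,
    is_distribution tau s mu /\
    forall U : set R, measurable U ->
      mu U = (\int[lebesgue_measure]_(x in U) (semicircle_density x)%:E)%E.

Definition circular (R : realType) (A : cstarAlgType R) (tau : A -> R[i])
    (v : R) (c : A) : Prop :=
  0 < v /\
  exists s : bool -> A,
    [/\ forall b, standard_semicircular tau (s b), free_family tau s &
        c = (Num.sqrt v / Num.sqrt 2)%:C *: (s false + 'i%C *: s true)].

Definition realPart (R : realType) (A : cstarAlgType R) (c : A) : A :=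
  (2^-1 : R[i]) *: (c + star c).

Definition imaginaryPart (R : realType) (A : cstarAlgType R) (c : A) : A :=
  ((2 * 'i%C)^-1 : R[i]) *: (c - star c).

Definition star_free_circular (R : realType) (A : cstarAlgType R)
    (tau : A -> R[i]) (J : Type) (c : J -> A) : Prop :=
  (forall j, exists v : R, circular tau v (c j)) /\
  free_family tau (fun jb : J * bool =>
    if jb.2 then imaginaryPart (c jb.1) else realPart (c jb.1)).

Definition mxstar (R : realType) (A : cstarAlgType R) (m n : nat)
    (M : 'M[A]_(m, n)) : 'M[A]_(n, m) :=
  \matrix_(i, j) star (M j i).

(* tr_d (x) tau *)
Definition mxstate (R : realType) (A : cstarAlgType R) (tau : A -> R[i])
    (d : nat) (X : 'M[A]_d) : R[i] :=
  d%:R^-1 * \sum_(i < d) tau (X i i).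

Definition W_SPN (R : realType) (A : cstarAlgType R) (p d : nat)
    (C : 'M[A]_(p, d)) (M : 'M[R[i]]_(p, d)) (sigma : R) : 'M[A]_d :=
  let X := \matrix_(i, j) ((M i j)%:A + sigma%:C *: C i j) in
  mxstar X *m X.

(* mu is the distribution of W_SPN C M sigma in (M_d(A), tr_d (x) tau). *)
Definition is_mu_SPN (R : realType) (A : cstarAlgType R) (tau : A -> R[i])
    (p d : nat) (C : 'M[A]_(p, d)) (M : 'M[R[i]]_(p, d)) (sigma : R)
    (mu : probability (measurableTypeR R) R) : Prop :=
  is_distribution (mxstate tau (d := d)) (W_SPN C M sigma) mu.

(* The roots of the characteristic polynomial, with multiplicity. *)
Definition eigenvalues (R : realType) (d : nat) (W : 'M[R[i]]_d) : seq R[i] :=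
  sval (closed_field_poly_normal (char_poly W)).

(* For self-adjoint W the eigenvalues are real, so that taking real parts
   merely casts them to R. *)
Definition esd (R : realType) (d : nat) (W : 'M[R[i]]_d) (U : set R) : \bar R :=
  ((d%:R^-1)%:E * (\sum_(l <- eigenvalues W) \d_(complex.Re l) U)%E)%E.

Definition conj_transpose (R : realType) (m n : nat) (M : 'M[R[i]]_(m, n)) :
    'M[R[i]]_(n, m) :=
  \matrix_(i, j) ((M j i)^*)%C.

(* Main.v *)
(* Put m_k(s) for the k-th moment of W(A, s) and t = s^2.  Free Gaussian
   integration by parts (the Schwinger-Dyson equation of a free semicircular
   family) turns the derivative of m_k into a quadratic expression in lower
   moments,
     d m_k / dt = k * sum_(a < k) m'_(k-1-a) m_a,
   where m'_0 = p/d and m'_l = m_l for l > 0.  Hence the moments are polynomials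
   in t determined by t and by their values tr((A^* A)^k) at t = 0, and the flow
   can be run backwards.  So equal measures with sigma^2 > rho^2 would give a
   matrix W(A, s), s^2 = sigma^2 - rho^2 > 0, whose moments are those of B^* B,
   i.e. of finitely many atoms.  By faithfulness W(A, s) is then annihilated by
   a nonzero polynomial; the Schwinger-Dyson equation converts such a relation
   into one of smaller degree, and finally into 1 = 0. *)

Require Import Defs.
From HB Require Import structures.
From mathcomp Require Import all_boot all_order all_algebra.
From mathcomp Require Import complex.
From mathcomp Require Import all_classical all_reals all_analysis.
From mathcomp Require Import measurable_realfun spectral ring lra.

Import Order.TTheory GRing.Theory Num.Theory.
Import numFieldNormedType.Exports.

Local Open Scope classical_set_scope.
Local Open Scope ring_scope.
Local Open Scope complex_scope.

Set Implicit Arguments.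
Unset Strict Implicit.
Unset Printing Implicit Defensive.

(** * Schwinger-Dyson equation for a free semicircular family *)

(** Freeness speaks only of alternating products of centered polynomials, whereas the entries of
    powers of W are arbitrary words; moreover the free difference quotient acts on expressions, not
    evidently on elements of the algebra. Each element is therefore carried together with a
    derivative, and the Schwinger-Dyson equation is proved for such pairs. The derivatives along the
    two parts of a circular entry are then combined so that a word in X and X^* is cut only at its
    letters X^*. The moment equation is obtained at real s, but as the moments are polynomials in s
    it becomes a formal identity. Since the derivative of m_k involves only lower moments, agreement
    at a single time forces equality of polynomials; running the flow backwards is then mere
    evaluation. In the final descent each step multiplies the leading coefficient of the relation by
    m_1, so what keeps it alive is that the trace of W(A, s) is nonzero for s nonzero. *)

Section FreeSemicircular.
Variables (R : realType) (A : cstarAlgType R) (tau : {scalar A}).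
Hypothesis tau1 : tau 1 = 1.
Variables (J : eqType) (y : J -> A) (v : R[i]).

Implicit Types (q f : {poly R[i]}) (b : J * {poly R[i]}).
Implicit Types (L M : seq (J * {poly R[i]})) (i j : J) (z : A).

Definition block_val b : A := horner_alg (y b.1) b.2.

Definition alternating_centered L : bool :=
  all (fun b => tau (block_val b) == 0) L && sorted (fun b c => b.1 != c.1) L.

Lemma alternating_centered_rev L :
  alternating_centered (rev L) = alternating_centered L.
Proof.
rewrite /alternating_centered all_rev rev_sorted; congr (_ && _).
by apply: eq_sorted => b c /=; rewrite eq_sym.
Qed.

Lemma alternating_centered_cons b L : alternating_centered (b :: L) =
  [&& tau (block_val b) == 0, (if L is c :: _ then b.1 != c.1 else true)
    & alternating_centered L].
Proof.
rewrite /alternating_centered /=; case: (tau _ == 0) => //=.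
by case: L => [|c L] //=; rewrite andbCA.
Qed.

Hypothesis hfree : free_family tau y.

Lemma tau_alternating L : alternating_centered L -> L != [::] ->
  tau (\prod_(b <- L) block_val b) = 0.
Proof.
case: L => // b0 L /andP[/allP hc hs] _; rewrite (big_nth b0).
apply: (hfree (j := fun l => (nth b0 (b0 :: L) l).1)) => //.
- move=> l lt_l; split; first by exists (nth b0 (b0 :: L) l).2.
  by apply/eqP/hc; rewrite mem_nth.
- by move=> l lt_l; apply/eqP; apply: (sortedP b0 hs).
Qed.

Lemma horner_algZ j c f :
  horner_alg (y j) (c *: f) = c *: horner_alg (y j) f.
Proof. by rewrite -mul_polyC rmorphM /= horner_algC -scalerAl mul1r. Qed.

Lemma centered_sub j f :
  tau (block_val (j, f - (tau (horner_alg (y j) f))%:P)) = 0.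
Proof.
by rewrite /block_val /= rmorphB /= horner_algC linearB /= linearZ /= tau1 /=
  mulr1 subrr.
Qed.

Lemma horner_algBC j f (c : R[i]) :
  horner_alg (y j) f = block_val (j, f - c%:P) + c%:A.
Proof. by rewrite /block_val /= rmorphB /= horner_algC subrK. Qed.

(** Splitting f(y_j) into its centered part and a scalar leaves two nonempty alternating centered
    products. *)
Lemma tau_horner_alternating j f b L : j != b.1 ->
  alternating_centered (b :: L) ->
  tau (horner_alg (y j) f * \prod_(c <- b :: L) block_val c) = 0.
Proof.
move=> jb hL; rewrite (horner_algBC _ _ (tau (horner_alg (y j) f))).
set b' := (j, _); rewrite mulrDl linearD /= -scalerAl mul1r linearZ /=.
rewrite (tau_alternating hL) // mulr0 addr0.
have -> : block_val b' * \prod_(c <- b :: L) block_val c =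
    \prod_(c <- [:: b', b & L]) block_val c by rewrite [RHS]big_cons.
apply: tau_alternating => //.
by rewrite alternating_centered_cons centered_sub eqxx jb.
Qed.

Lemma tau_alternating_horner j f b L : j != b.1 ->
  alternating_centered (b :: L) ->
  tau ((\prod_(c <- rev (b :: L)) block_val c) * horner_alg (y j) f) = 0.
Proof.
move=> jb hL; rewrite (horner_algBC _ _ (tau (horner_alg (y j) f))).
set b' := (j, _); rewrite mulrDr linearD /= -scalerAr mulr1 linearZ /=.
have rn (c : J * {poly R[i]}) s : rev (c :: s) != [::].
  by rewrite -size_eq0 size_rev.
rewrite [tau (\prod_(c <- rev (b :: L)) _)]tau_alternating //; last first.
  by rewrite alternating_centered_rev.
rewrite mulr0 addr0.
have -> : (\prod_(c <- rev (b :: L)) block_val c) * block_val b' =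
    \prod_(c <- rev [:: b', b & L]) block_val c.
  by rewrite (rev_cons b') [RHS]big_rcons.
apply: tau_alternating => //.
by rewrite alternating_centered_rev alternating_centered_cons centered_sub eqxx
  jb.
Qed.

Definition slice_monom (theta : nat -> R[i]) k : {poly R[i]} :=
  \sum_(a < k) theta (k.-1 - a)%N *: 'X^a.

(* [slice_deriv theta] is (id (x) theta) applied to the difference quotient
   (q(X) - q(Y))/(X - Y), where [theta n] is the value at Y^n. *)
Definition slice_deriv theta q : {poly R[i]} :=
  \sum_(k < size q) q`_k *: slice_monom theta k.

Lemma slice_derivE theta q n : (size q <= n)%N ->
  slice_deriv theta q = \sum_(k < n) q`_k *: slice_monom theta k.
Proof.
move=> le_n; rewrite /slice_deriv.
rewrite (big_ord_widen n (fun k => q`_k *: slice_monom theta k)) //.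
rewrite big_mkcond; apply: eq_bigr => k _.
by case: ltnP => // le_k; rewrite nth_default ?scale0r.
Qed.

Lemma slice_derivD theta q f :
  slice_deriv theta (q + f) = slice_deriv theta q + slice_deriv theta f.
Proof.
set n := maxn (size q) (size f).
rewrite !(@slice_derivE _ _ n) ?leq_maxl ?leq_maxr ?size_polyD //.
by rewrite -big_split; apply: eq_bigr => k _; rewrite coefD scalerDl.
Qed.

Lemma slice_derivC theta c : slice_deriv theta c%:P = 0.
Proof.
by rewrite (@slice_derivE _ _ 1) ?size_polyC ?leq_b1 // big_ord1
  /slice_monom big_ord0 scaler0.
Qed.

Lemma slice_derivXn theta k :
  slice_deriv theta 'X^k = slice_monom theta k.
Proof.
rewrite /slice_deriv size_polyXn big_ord_recr /= coefXn eqxx scale1r.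
rewrite big1 ?add0r // => l _.
by rewrite coefXn (ltn_eqF (ltn_ord l)) scale0r.
Qed.

(** From X q(X) - Y q(Y) = (X - Y) q(X) + Y (q(X) - q(Y)); the extra factor Y shifts [theta]. *)
Lemma slice_derivMX theta q :
  slice_deriv theta (q * 'X) =
  theta 0%N *: q + slice_deriv (fun n => theta n.+1) q.
Proof.
rewrite (@slice_derivE _ _ (size q).+1); last first.
  by rewrite (leq_trans (size_polyMleq _ _)) // size_polyX addn2.
rewrite big_ord_recl coefMX /= scale0r add0r.
have -> : theta 0%N *: q = theta 0%N *: \sum_(k < size q) q`_k *: 'X^k.
  by rewrite -poly_def coefK.
rewrite scaler_sumr /slice_deriv -big_split; apply: eq_bigr => k _ /=.
rewrite coefMX /= scalerA mulrC -scalerA -scalerDr; congr (_ *: _).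
rewrite /slice_monom big_ord_recr /= subnn addrC; congr (_ + _).
apply: eq_bigr => a _; rewrite -subSn ?subn1 //.
  by rewrite prednK // (leq_ltn_trans _ (ltn_ord a)).
by rewrite -ltnS prednK ?ltn_ord // (leq_ltn_trans _ (ltn_ord a)).
Qed.

Lemma slice_deriv0 q : slice_deriv (fun=> 0) q = 0.
Proof.
by rewrite /slice_deriv big1 // => k _;
  rewrite /slice_monom big1 ?scaler0 // => a _;
  rewrite scale0r.
Qed.

Lemma eq_slice_deriv theta theta' q : theta =1 theta' ->
  slice_deriv theta q = slice_deriv theta' q.
Proof. by move=> /funext ->. Qed.

Lemma slice_deriv_thetaD theta theta' q :
  slice_deriv (fun n => theta n + theta' n) q =
  slice_deriv theta q + slice_deriv theta' q.
Proof.
rewrite /slice_deriv -big_split; apply: eq_bigr => k _ /=.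
rewrite -scalerDr /slice_monom -big_split; congr (_ *: _).
by apply: eq_bigr => a _; rewrite scalerDl.
Qed.

Lemma slice_deriv_thetaZ c theta q :
  slice_deriv (fun n => c * theta n) q = c *: slice_deriv theta q.
Proof.
rewrite /slice_deriv scaler_sumr; apply: eq_bigr => k _ /=.
rewrite [RHS]scalerA [c * _]mulrC -scalerA; congr (_ *: _).
rewrite /slice_monom scaler_sumr.
by apply: eq_bigr => a _; rewrite scalerA.
Qed.

(* A noncommutative polynomial in y is recorded by its value a and the maps
   z |-> (id (x) tau)(d_i a * (1 (x) z)), where d_i is the free difference
   quotient; [dmul] is the Leibniz rule in this encoding. *)
Local Notation ncjet := (A * (J -> A -> A))%type.

Definition dmul (a b : ncjet) : ncjet :=
  (a.1 * b.1, fun i z => a.1 * b.2 i z + a.2 i (b.1 * z)).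

Definition block b : ncjet :=
  (block_val b, fun i z => if i == b.1 then
     horner_alg (y b.1) (slice_deriv (fun n => tau (y b.1 ^+ n * z)) b.2)
   else 0).

(** The head of the list is the rightmost factor, so that extending a word on the right is a
    cons. *)
Fixpoint blocks L : ncjet :=
  if L is b :: L' then dmul (blocks L') (block b) else (1, fun _ _ => 0).

Lemma blocks_val L : (blocks L).1 = \prod_(b <- rev L) block_val b.
Proof.
by elim: L => [|b L IH]; rewrite ?big_nil // rev_cons big_rcons /= IH.
Qed.

Lemma block_derivD b i z z' :
  (block b).2 i (z + z') = (block b).2 i z + (block b).2 i z'.
Proof.
rewrite /=; case: eqP => _; last by rewrite addr0.
rewrite -rmorphD /= -slice_deriv_thetaD; congr (horner_alg _ _).
by apply: eq_slice_deriv => n; rewrite mulrDr linearD.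
Qed.

Lemma block_derivZ b i c z : (block b).2 i (c *: z) = c *: (block b).2 i z.
Proof.
rewrite /=; case: eqP => _; last by rewrite scaler0.
transitivity (horner_alg (y b.1)
    (c *: slice_deriv (fun n => tau (y b.1 ^+ n * z)) b.2)); last first.
  by rewrite horner_algZ.
rewrite -slice_deriv_thetaZ; congr (horner_alg _ _).
by apply: eq_slice_deriv => n; rewrite -scalerAr linearZ.
Qed.

Lemma blocks_deriv_cons b L i z : (blocks (b :: L)).2 i z =
  (blocks L).1 * (block b).2 i z + (blocks L).2 i (block_val b * z).
Proof. by []. Qed.

Lemma blocks_derivD L i z z' :
  (blocks L).2 i (z + z') = (blocks L).2 i z + (blocks L).2 i z'.
Proof.
elim: L z z' => [|b L IH] z z'; first by rewrite addr0.
by rewrite !blocks_deriv_cons block_derivD !mulrDr IH addrACA.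
Qed.

Lemma blocks_derivZ L i c z : (blocks L).2 i (c *: z) = c *: (blocks L).2 i z.
Proof.
elim: L z => [|b L IH] z; first by rewrite scaler0.
by rewrite !blocks_deriv_cons block_derivZ -!scalerAr IH -scalerDr.
Qed.

(** A cut inside a block of [L] puts under the trace a power of that block's variable followed by a
    nonempty alternating centered word that starts with another index; such a trace is zero. *)
Lemma blocks_deriv_alternating L b M i :
  alternating_centered (catrev L (b :: M)) ->
  (blocks L).2 i (\prod_(c <- b :: M) block_val c) = 0.
Proof.
elim: L b M => //= c L IH b M hL.
have E : block_val c * \prod_(x <- b :: M) block_val x =
    \prod_(x <- [:: c, b & M]) block_val x by rewrite [RHS]big_cons.
rewrite E IH // addr0.
case: eqP => _; last by rewrite mulr0.
rewrite (eq_slice_deriv _ (theta' := fun=> 0)); last first.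
  move=> n; rewrite -[y c.1](horner_algX (y c.1)) -rmorphXn.
  have : alternating_centered [:: c, b & M].
    move: hL; rewrite catrevE /alternating_centered all_cat.
    by case/andP => /andP[_ ->] /cat_sorted2[_].
  rewrite alternating_centered_cons => /and3P[_ cb hM].
  exact: tau_horner_alternating.
by rewrite slice_deriv0 rmorph0 mulr0.
Qed.

(** The Catalan recursion of a centered semicircular law of variance [v], which is the
    Schwinger-Dyson equation for powers of one variable. At n = 0 the empty sum says that [y j] is
    centered. *)
Hypothesis hmom : forall j n, tau (y j ^+ n.+1) =
  v * \sum_(a < n) tau (y j ^+ (n.-1 - a)) * tau (y j ^+ a).

Definition schwinger_dyson (a : ncjet) :=
  forall i, tau (y i * a.1) = v * tau (a.2 i 1).

Lemma tau_slice_deriv j q : tau (y j * horner_alg (y j) q) =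
  v * tau (horner_alg (y j) (slice_deriv (fun n => tau (y j ^+ n)) q)).
Proof.
rewrite -{1}(coefK q) poly_def /slice_deriv !raddf_sum /= mulr_sumr.
rewrite !raddf_sum mulr_sumr; apply: eq_bigr => k _ /=.
rewrite !horner_algZ -scalerAr !linearZ /= rmorphXn /= horner_algX -exprS hmom.
rewrite mulrCA; congr (_ * (_ * _)); rewrite /slice_monom !raddf_sum /=.
by apply: eq_bigr => a _;
  rewrite horner_algZ linearZ /= rmorphXn /= horner_algX.
Qed.

(** With two blocks or more, freeness annihilates both sides; a single block of index [i] is the
    moment recursion of one variable. *)
Lemma schwinger_dyson_alternating L :
  alternating_centered L -> schwinger_dyson (blocks L).
Proof.
move=> hL i.
have hL' : alternating_centered (rev L) by rewrite alternating_centered_rev.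
case: L hL hL' => [|b [|c L]] hL hL'.
- by rewrite /= linear0 mulr0 mulr1 -[y i]expr1 hmom big_ord0 mulr0.
- rewrite /= !mul1r addr0; case: (eqVneq i b.1) => [->|ib].
    rewrite /block_val tau_slice_deriv; congr (_ * tau (horner_alg _ _)).
    by apply: eq_slice_deriv => n; rewrite mulr1.
  rewrite linear0 mulr0 -[y i]horner_algX.
  by have := tau_horner_alternating 'X ib hL; rewrite big_seq1.
set M := [:: b, c & L] in hL hL' *.
transitivity (0 : R[i]).
  rewrite blocks_val; case ErM : (rev M) hL' => [|e K] hL'.
    by move/(congr1 size): ErM; rewrite size_rev.
  case: (eqVneq i e.1) => [ie|ie]; last first.
    by rewrite -[y i](horner_algX (y i)); apply: tau_horner_alternating.
  rewrite big_cons mulrA ie -{1}[y e.1](horner_algX (y e.1)) /block_val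
    -rmorphM.
  case: K hL' ErM => [|f K] hL' ErM.
    by move/(congr1 size): ErM; rewrite size_rev.
  move: hL'; rewrite alternating_centered_cons => /and3P[_ ef hK].
  exact: tau_horner_alternating.
(* Cuts to the left of the last block vanish; a cut inside it leaves an alternating word followed by
   a polynomial in a variable of another index. *)
have := @blocks_deriv_alternating (c :: L) b [::] i.
rewrite big_seq1 /M (blocks_deriv_cons b) mulr1 => ->; last first.
  by rewrite -[X in alternating_centered X]/(rev M).
rewrite addr0 /block /=; case: eqP => _; last by rewrite mulr0 linear0 mulr0.
have := hL; rewrite alternating_centered_cons => /and3P[_ bc hcL].
have := tau_alternating_horner
  (slice_deriv (fun n => tau (y b.1 ^+ n * 1)) b.2) bc hcL.
by rewrite -blocks_val => ->; rewrite mulr0.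
Qed.

(* Stability under multiplication on the right of alternating centered
   products is what makes the induction on words go through. *)
Definition schwinger_dyson_stable (b : ncjet) :=
  forall L, alternating_centered L -> schwinger_dyson (dmul (blocks L) b).

Lemma stable_ext (a b : ncjet) : a.1 = b.1 ->
  (forall i z, a.2 i z = b.2 i z) ->
  schwinger_dyson_stable a -> schwinger_dyson_stable b.
Proof. by move=> h1 h2 ha L hL i; have := ha L hL i; rewrite /= h1 h2. Qed.

Lemma stable1 : schwinger_dyson_stable (1, fun _ _ => 0).
Proof.
move=> L hL i; have := schwinger_dyson_alternating hL i.
by rewrite /= mulr0 add0r !mulr1.
Qed.

Lemma stableD (a b : ncjet) :
  schwinger_dyson_stable a -> schwinger_dyson_stable b ->
  schwinger_dyson_stable (a.1 + b.1, fun i z => a.2 i z + b.2 i z).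
Proof.
move=> ha hb L hL i; have := ha L hL i; have := hb L hL i.
rewrite /= !mulr1 !mulrDr !(linearD tau) /= blocks_derivD linearD /=.
by move=> -> ->; rewrite -!mulrDr addrACA.
Qed.

Lemma stableZ c (a : ncjet) :
  schwinger_dyson_stable a ->
  schwinger_dyson_stable (c *: a.1, fun i z => c *: a.2 i z).
Proof.
move=> ha L hL i; have := ha L hL i.
rewrite /= !mulr1 -!scalerAr blocks_derivZ -scalerDr !linearZ /= => ->.
by rewrite mulrCA.
Qed.

Lemma dmulA (a b c : ncjet) : dmul a (dmul b c) = dmul (dmul a b) c.
Proof.
rewrite /dmul /= mulrA; congr pair; apply/funext => i; apply/funext => z.
by rewrite mulrDr !mulrA addrA.
Qed.

Definition var j : ncjet :=
  (y j, fun i z => if i == j then (tau z)%:A else 0).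

Lemma block_var j : block (j, 'X) = var j.
Proof.
rewrite /block /block_val /= horner_algX; congr pair.
apply/funext => i; apply/funext => z; case: eqP => // _.
rewrite -['X]expr1 slice_derivXn /slice_monom big_ord1 horner_algZ rmorph1.
by rewrite mul1r.
Qed.

Lemma block_mul_var j q : dmul (block (j, q)) (var j) = block (j, q * 'X).
Proof.
rewrite /block /block_val /dmul /= rmorphM /= horner_algX; congr pair.
apply/funext => i; apply/funext => z; case: eqP => _;
  last by rewrite mulr0 addr0.
rewrite slice_derivMX rmorphD /= horner_algZ mul1r -scalerAr mulr1.
congr (_ + horner_alg _ _).
by apply: eq_slice_deriv => n; rewrite mulrA -exprSr.
Qed.

(** Constants have derivative zero, so an uncentered block is its centered version plus [c] times
    the word without it. *)
Lemma schwinger_dyson_blockBC L j q c (b : ncjet) :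
  schwinger_dyson (dmul (blocks ((j, q - c%:P) :: L)) b) ->
  schwinger_dyson (dmul (blocks L) b) ->
  schwinger_dyson (dmul (blocks ((j, q) :: L)) b).
Proof.
move=> h1 h2 i; move: (h1 i) (h2 i).
have E : block_val (j, q) = block_val (j, q - c%:P) + c%:A.
  exact: horner_algBC.
have E2 z : (block (j, q)).2 i z = (block (j, q - c%:P)).2 i z.
  by rewrite /block /=; case: eqP => // _; rewrite slice_derivD -polyCN
    slice_derivC addr0.
have e1 f : (dmul (blocks ((j, f) :: L)) b).1 =
    (blocks L).1 * (block_val (j, f) * b.1) by rewrite mulrA.
have e2 f : (dmul (blocks ((j, f) :: L)) b).2 i 1 =
    (blocks L).1 * (block_val (j, f) * b.2 i 1 + (block (j, f)).2 i b.1) +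
    (blocks L).2 i (block_val (j, f) * b.1).
  by rewrite {1}/dmul [LHS]/= mulr1 mulrDr -addrA mulrA.
rewrite !e1 !e2 E E2 {e1 e2 E E2} /= mulr1.
move: (block_val _) (if _ then _ else _) => x g e1 e2.
rewrite !mulrDl -!scalerAl !mul1r blocks_derivD blocks_derivZ.
rewrite !mulrDr -!scalerAr linearD linearZ /= e1 e2.
rewrite mulrCA -mulrDr; congr (_ * _); rewrite -linearZ -linearD /=.
congr (tau _); rewrite scalerDr !mulrDr.
by rewrite addrACA; congr (_ + _); rewrite addrAC.
Qed.

(** If the last block of the word has another index, [y j] is a new centered block. Otherwise it is
    absorbed into that block, which must then be recentered; both the recentered and the shortened
    word are alternating. *)
Lemma stable_var j (b : ncjet) :
  schwinger_dyson_stable b -> schwinger_dyson_stable (dmul (var j) b).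
Proof.
move=> hb L hL; rewrite dmulA.
case: (boolP (if L is c :: _ then j != c.1 else true)) => hj.
  rewrite -block_var; apply: (hb ((j, 'X) :: L)).
  rewrite alternating_centered_cons hj hL andbT andbT.
  by rewrite /block_val /= horner_algX -[y j]expr1 hmom big_ord0 mulr0.
case: L hL hj => // -[j' q] L hL /negPn /eqP /= jj'; rewrite -{j'}jj' in hL *.
rewrite -(dmulA (blocks L)) block_mul_var -/(blocks ((j, q * 'X) :: L)).
move: hL; rewrite alternating_centered_cons => /and3P[_ hj hL].
apply: (@schwinger_dyson_blockBC _ _ _ (tau (horner_alg (y j) (q * 'X)))).
  by apply: hb; rewrite alternating_centered_cons centered_sub eqxx /=;
    apply/andP.
exact: hb.
Qed.

(** A relation rather than a function: different expressions might give the same element with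
    different derivatives. *)
Inductive ncpoly : A -> (J -> A -> A) -> Prop :=
  | Ncpoly_const c : ncpoly c%:A (fun _ _ => 0)
  | Ncpoly_var j : ncpoly (y j) (fun i z => if i == j then (tau z)%:A else 0)
  | Ncpoly_add (a b : A) da db : ncpoly a da -> ncpoly b db ->
      ncpoly (a + b) (fun i z => da i z + db i z)
  | Ncpoly_mul (a b : A) da db : ncpoly a da -> ncpoly b db ->
      ncpoly (a * b) (fun i z => a * db i z + da i (b * z)).

Lemma ncpoly_stable a da (b : ncjet) : ncpoly a da ->
  schwinger_dyson_stable b -> schwinger_dyson_stable (dmul (a, da) b).
Proof.
move=> ha; elim: ha b => {a da} [c|j|a a' da da' _ IH _ IH'|a a' da da' _ IH _
  IH'] b hb.
- apply: stable_ext (stableZ c hb) => [|i z] /=;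
  first by rewrite -scalerAl mul1r.
  by rewrite addr0 -scalerAl mul1r.
- exact: stable_var.
- apply: stable_ext (stableD (IH _ hb) (IH' _ hb)) => [|i z] /=.
    by rewrite mulrDl.
  by rewrite mulrDl addrACA.
- by have := IH _ (IH' _ hb); rewrite dmulA.
Qed.

Theorem free_schwinger_dyson a da i : ncpoly a da ->
  tau (y i * a) = v * tau (da i 1).
Proof.
move=> ha; have := ncpoly_stable ha stable1 (isT : alternating_centered [::]) i.
by rewrite /= !mulr1 !mulr0 mul1r !add0r mul1r addr0.
Qed.

End FreeSemicircular.

(** * Moments of the semicircle law *)

Section CompactlySupported.
Variables (R : realType) (mu : probability (measurableTypeR R) R) (M : R).
Hypothesis hM : mu (~` `[- M, M]) = 0%E.

Lemma continuous_measurableR (f : R -> R) :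
  continuous f -> measurable_fun [set: measurableTypeR R] f.
Proof. by move=> cf; exact: continuous_measurable_fun. Qed.

Lemma continuous_integrable_segment (f : R -> R) : continuous f ->
  mu.-integrable `[- M, M] (EFin \o f).
Proof.
move=> cf; apply: measurable_bounded_integrable => //.
- by rewrite (le_lt_trans (probability_le1 _ _)) ?ltry.
- by apply: measurable_funTS; exact: continuous_measurableR cf.
- have /compact_bounded[B [_ hB]] :=
    continuous_compact (continuous_subspaceT cf) (@segment_compact R (- M) M).
  by exists B; split; rewrite ?num_real // => ? ? ? ?; exact: hB.
Qed.

Lemma continuous_integrable (f : R -> R) : continuous f ->
  mu.-integrable setT (EFin \o f).
Proof.
move=> cf; apply/(@negligible_integrable _ _ _ mu _ (~` `[- M, M])) => //.
- exact: measurableC.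
- by apply/measurable_EFinP; exact: continuous_measurableR cf.
- by rewrite setDE setTI setCK; exact: continuous_integrable_segment.
Qed.

Lemma integral_segment (f : R -> R) : continuous f ->
  (\int[mu]_x (f x)%:E = \int[mu]_(x in `[(- M)%R, M]) (f x)%:E)%E.
Proof.
move=> cf; rewrite (@negligible_integral _ _ _ mu _ (~` `[- M, M])) //.
- by rewrite setDE setTI setCK.
- exact: measurableC.
- exact: continuous_integrable.
Qed.

Lemma Rintegral_poly (q : {poly R}) :
  \int[mu]_x q.[x] = \sum_(k < size q) q`_k * \int[mu]_x x ^+ k.
Proof.
have iX c k : mu.-integrable setT (EFin \o (fun x : R => c * x ^+ k)).
  apply: continuous_integrable => x.
  by apply: cvgM; [exact: cvg_cst|exact: exprn_continuous].
under eq_Rintegral do rewrite horner_coef.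
elim: (size q) => [|n IH].
  rewrite big_ord0; under eq_Rintegral do rewrite big_ord0.
  by rewrite /Rintegral integral0.
rewrite big_ord_recr -IH /=; under eq_Rintegral do rewrite big_ord_recr.
rewrite RintegralD //.
  rewrite RintegralZl //; apply: continuous_integrable; exact: exprn_continuous.
apply: continuous_integrable.
suff -> : (fun x => \sum_(i < n) q`_i * x ^+ i) =
    horner (\poly_(i < n) q`_i) by exact: continuous_horner.
by apply/funext => x; rewrite horner_poly.
Qed.

End CompactlySupported.

Section Semicircle.
Variables (R : realType) (mu : probability (measurableTypeR R) R).
Local Notation lam := (@lebesgue_measure R).
Hypothesis hmu : forall U : set R, measurable U ->
  mu U = (\int[lam]_(x in U) (semicircle_density x)%:E)%E.

Lemma sqrt_semicircle_continuous :
  continuous (fun x : R => Num.sqrt (4 - x ^+ 2)).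
Proof.
move=> x; apply: (@continuous_comp _ _ _ (fun x : R => 4 - x ^+ 2) Num.sqrt).
  by apply: cvgB; [exact: cvg_cst|exact: exprn_continuous].
exact: sqrt_continuous.
Qed.

Lemma measurable_semicircle_density :
  measurable_fun setT (@semicircle_density R : measurableTypeR R -> R).
Proof.
apply: measurable_funM; last exact: measurable_indic.
apply: measurable_funM => //; apply: continuous_measurableR.
exact: sqrt_semicircle_continuous.
Qed.

Lemma semicircle_support : mu (~` `[- 2, 2]) = 0%E.
Proof.
rewrite hmu; last exact: measurableC.
apply: integral0_eq => x hx; rewrite /semicircle_density indicE.
by rewrite memNset // mulr0.
Qed.

(** The law is given by its values on sets only, so the density enters through the Radon-Nikodym
    derivative, which agrees with it almost everywhere because both have the same integral over
    every measurable set. *)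
Lemma integral_semicircle (f : R -> R) : continuous f ->
  (\int[mu]_(x in `[(- 2)%R, 2%R]) (f x)%:E =
   \int[lam]_(x in `[(- 2)%R, 2%R]) (f x * semicircle_density x)%:E)%E.
Proof.
move=> cf; have dom : mu `<< lam.
  apply/null_content_dominatesP => U mU U0; rewrite hmu //.
  apply: null_set_integral => //; apply/measurable_EFinP.
  by apply: measurable_funTS; exact: measurable_semicircle_density.
have mf : measurable_fun (`[- 2, 2] : set (measurableTypeR R)) (EFin \o f).
  apply/measurable_EFinP; apply: measurable_funTS.
  exact: continuous_measurableR cf.
rewrite -(Radon_Nikodym_change_of_variables dom) //; last first.
  exact: continuous_integrable_segment cf.
under [RHS]eq_integral do rewrite EFinM.
apply: ae_eq_integral => //.
- apply: emeasurable_funM => //; apply: (measurable_int lam).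
  apply: (integrableS _ _ (@subsetT _ _)) => //.
  exact: Radon_Nikodym_integrable.
- apply: emeasurable_funM => //; apply/measurable_EFinP.
  by apply: measurable_funTS; exact: measurable_semicircle_density.
- apply: ae_eqe_mul2l; rewrite Radon_NikodymE /=.
  case: cid => /= h [h1 h2 h3].
  apply: integral_ae_eq => //.
  + exact: integrableS h2.
  + apply/measurable_EFinP; apply: measurable_funTS.
    exact: measurable_semicircle_density.
  + by move=> E _ mE; rewrite -h3 // -hmu.
Qed.

(* The integrand is the derivative of x^k (4 - x^2)^(3/2) / (2 pi). *)
Lemma integral_semicircle_recurrence k :
  (\int[lam]_(x in `[(- 2)%R, 2%R])
     ((4 * k%:R * x ^+ k.-1 - (k + 3)%:R * x ^+ k.+1) *
      semicircle_density x)%:E = 0)%E.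
Proof.
(* At k = 0 the truncated exponent [k.-1] is harmless thanks to the factor [k%:R]. *)
have xk (x : R) : k%:R * x ^+ k.-1 * x ^+ 2 = k%:R * x ^+ k.+1.
  by case: k => [|k]; rewrite ?mul0r // -mulrA -exprD addn2.
pose q : {poly R} := 4%:P - 'X^2.
pose c : R := (2 * pi)^-1.
pose g : {poly R} := (4 * k%:R) *: 'X^(k.-1) - (k + 3)%:R *: 'X^(k.+1).
pose s (x : R) : R := Num.sqrt q.[x].
have qE x : q.[x] = 4 - x ^+ 2 by rewrite /q !hornerE.
have cs : continuous s.
  move=> x; apply: (@continuous_comp _ _ _ (horner q) Num.sqrt).
    exact: continuous_horner.
  exact: sqrt_continuous.
have gE x : g.[x] = 4 * k%:R * x ^+ k.-1 - (k + 3)%:R * x ^+ k.+1.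
  by rewrite /g !hornerE.
transitivity (\int[lam]_(x in `[(- 2)%R, 2%R]) ((c *: g).[x] * s x)%:E)%E.
  apply: eq_integral => x hx; congr EFin.
  rewrite /semicircle_density indicE hx mulr1 /s qE hornerZ gE -/c.
  by rewrite [X in _ * X]mulrC mulrA [_ * c]mulrC.
pose p : {poly R} := c *: ('X^k * q).
pose F (x : R) := p.[x] * s x.
have cF : continuous F.
  by move=> x; apply: cvgM; [exact: continuous_horner|exact: cs].
have F0 x : q.[x] = 0 -> F x = 0 by rewrite /F /s => ->; rewrite sqrtr0 mulr0.
have dF (x : R) : x \in `](- 2), 2[ -> is_derive x (1 : R) F ((c *: g).[x] * s
  x).
  rewrite in_itv /= => /andP[x1 x2].
  have q0 : 0 < q.[x] by rewrite qE; nra.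
  have ds : is_derive x (1 : R) s ((2 * Num.sqrt q.[x])^-1 * q^`().[x]).
    apply: (@is_derive1_comp _ Num.sqrt (horner q)).
    exact: is_derive1_sqrt.
  have dp := is_derive_poly p x.
  apply: (is_derive_eq (is_deriveM dp ds)).
  have s0 : s x != 0 by rewrite gt_eqF // sqrtr_gt0.
  have sq : s x * s x = q.[x] by rewrite -expr2 sqr_sqrtr // ltW.
  have dq : q^`().[x] = - (2 * x).
    by rewrite /q derivB derivC derivXn !hornerE /=; ring.
  have dpE : p^`().[x] = c * (k%:R * x ^+ k.-1 * q.[x] - 2 * x ^+ k.+1).
    rewrite /p derivZ hornerZ derivM hornerD !hornerM derivXn dq.
    by rewrite hornerMn !hornerXn -mulr_natl exprS; ring.
  have pE : p.[x] = c * (x ^+ k * q.[x]) by rewrite /p hornerZ hornerM hornerXn.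
  rewrite /GRing.scale /= -/(s x) dpE pE dq hornerZ gE.
  have -> : c * (x ^+ k * q.[x]) * ((2 * s x)^-1 * - (2 * x)) =
      - (c * x ^+ k.+1 * s x).
    rewrite -sq exprS; field; exact: s0.
  have -> : k%:R * x ^+ k.-1 * q.[x] =
      4 * k%:R * x ^+ k.-1 - k%:R * x ^+ k.+1 by rewrite qE -xk; ring.
  by rewrite natrD; ring.
(* The product rule fails at the endpoints, where the square root is not differentiable; continuity
   of [F] suffices there, and [F] vanishes at both. *)
rewrite (@continuous_FTC2 _ _ F).
- by rewrite !F0 ?qE ?subee //; ring.
- by lra.
- apply: continuous_subspaceT => x; apply: cvgM; last exact: cs.
  exact: continuous_horner.
- split.
  + by move=> x hx; have [] := dF x hx.
  + by apply: cvg_at_right_filter; exact: cF.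
  + by apply: cvg_at_left_filter; exact: cF.
- by move=> x hx; rewrite derive1E; have := dF x hx => -[] _ ->.
Qed.

Lemma semicircle_moment_recurrence k :
  (k + 3)%:R * (\int[mu]_x x ^+ k.+1) = 4 * k%:R * (\int[mu]_x x ^+ k.-1).
Proof.
have cX n : continuous (fun x : R => x ^+ n) by exact: exprn_continuous.
have iX n : mu.-integrable setT (EFin \o (fun x : R => x ^+ n)).
  exact: (continuous_integrable semicircle_support).
have iZ (c : R) n : mu.-integrable setT (EFin \o (fun x : R => c * x ^+ n)).
  apply: (continuous_integrable semicircle_support) => x.
  by apply: cvgM; [exact: cvg_cst|exact: cX].
rewrite -!RintegralZl //; apply/esym/eqP; rewrite -subr_eq0 -RintegralB //.
rewrite /Rintegral (integral_segment semicircle_support); last first.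
  by move=> x; apply: cvgB; apply: cvgM;
    [exact: cvg_cst|exact: cX|exact: cvg_cst|exact: cX].
rewrite integral_semicircle; last first.
  by move=> x; apply: cvgB; apply: cvgM;
    [exact: cvg_cst|exact: cX|exact: cvg_cst|exact: cX].
by rewrite integral_semicircle_recurrence.
Qed.

End Semicircle.

(** The self-convolution [S] obeys the same two-step recurrence as [m] shifted by two. The symmetry
    a -> n - a replaces the weight n + 4 by 2 (a + 2) under the sum, and a + 2 = (a - 1) + 3 is the
    coefficient to which the hypothesis applies. *)
Lemma catalan_convolution (F : numFieldType) (m : nat -> F) : m 0 = 1 ->
  (forall k, (k + 3)%:R * m k.+1 = 4 * k%:R * m k.-1) ->
  forall n, m n.+1 = \sum_(a < n) m (n.-1 - a)%N * m a.
Proof.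
move=> m0 hm.
have m1 : m 1%N = 0.
  by apply/eqP; have /eqP := hm 0%N; rewrite mulr0 mul0r mulf_eq0 pnatr_eq0.
pose S n := \sum_(a < n.+1) m a * m (n - a)%N.
pose T n := \sum_(a < n.+1) a%:R * (m a * m (n - a)%N).
have hT n : 2 * T n = n%:R * S n.
  rewrite mulr2n mulrDl mul1r {2}/T (reindex_inj rev_ord_inj) /= -big_split.
  rewrite mulr_sumr; apply: eq_bigr => a _ /=.
  have le_a : (a <= n)%N by rewrite -ltnS.
  rewrite subSS subKn // [m (n - a)%N * m a]mulrC -mulrDl.
  by rewrite -natrD subnKC.
suff hS n : m n.+2 = S n.
  case=> [|n]; first by rewrite big_ord0.
  by rewrite hS; apply: eq_bigr => a _; rewrite mulrC.
suff : m n.+2 = S n /\ m n.+3 = S n.+1 by case.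
elim: n => [|n [IH0 IH1]].
  rewrite /S !big_ord_recr !big_ord0 /= m0 m1 !mulr0 !mul0r !add0r !mulr1.
  have := hm 1%N; have := hm 2%N; rewrite /= m0 m1 mulr0 mulr1.
  move=> /eqP; rewrite mulf_eq0 pnatr_eq0 /= => /eqP ->.
  have n4 : (4 : F) != 0 by rewrite pnatr_eq0.
  by rewrite mulr1 => h; split=> //; apply: (mulfI n4); rewrite mulr1.
split=> //.
have n6 : (n.+2 + 4)%:R != 0 :> F by rewrite pnatr_eq0 addnS.
apply: (mulfI n6).
have -> : (n.+2 + 4)%:R * S n.+2 = 2 * T n.+2 + 4 * S n.+2.
  by rewrite hT natrD mulrDl.
have -> : 2 * T n.+2 + 4 * S n.+2 =
    2 * \sum_(a < n.+3) (a + 2)%:R * (m a * m (n.+2 - a)%N).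
  suff -> : \sum_(a < n.+3) (a + 2)%:R * (m a * m (n.+2 - a)%N) =
      T n.+2 + 2 * S n.+2 by ring.
  rewrite mulr_sumr -big_split; apply: eq_bigr => a _ /=.
  by rewrite natrD mulrDl.
rewrite big_ord_recl big_ord_recl /= /bump /= m1 mul0r mulr0 add0r m0 subn0
  mul1r.
have -> : \sum_(a < n.+1) (1 + (1 + a) + 2)%:R *
      (m (1 + (1 + a))%N * m (n.+2 - (1 + (1 + a)))%N) = 4 * (T n + S n).
  rewrite mulrDr !mulr_sumr -big_split; apply: eq_bigr => a _ /=.
  rewrite !add1n !subSS mulrA (_ : (a.+2 + 2 = a.+1 + 3)%N) ?hm /=; last first.
    by rewrite !addSn !addnS.
  by rewrite -[a.+1]addn1 natrD; ring.
have -> : 2 * (2 * m n.+2 + 4 * (T n + S n)) =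
   4 * m n.+2 + 4 * (2 * T n) + 8 * S n by ring.
rewrite hT -IH0 (_ : (n.+2 + 4 = n.+3 + 3)%N) ?hm /=; last first.
  by rewrite !addSn !addnS.
by rewrite -[n.+3]addn3 natrD; ring.
Qed.

(** * Circular matrices *)

Section Star.
Variables (R : realType) (A : cstarAlgType R).
Implicit Types (x y : A) (z : R[i]).

Lemma star1 : star (1 : A) = 1.
Proof. by rewrite -[LHS]mulr1 -{2}[1](starK (1 : A)) -starM mulr1 starK. Qed.

Lemma star0 : star (0 : A) = 0.
Proof. by apply: (@addIr _ (star 0)); rewrite -starD !add0r. Qed.

Lemma star_alg z : star (z%:A : A) = ((z^*)%C)%:A.
Proof. by rewrite starZ star1. Qed.

Lemma star_sum (I : Type) (r : seq I) (P : pred I) (F : I -> A) :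
  star (\sum_(i <- r | P i) F i) = \sum_(i <- r | P i) star (F i).
Proof. exact: (big_morph _ (@starD _ A) star0). Qed.

End Star.

Section MatrixTrace.
Variables (R : realType) (A : cstarAlgType R) (tau : {scalar A}).
Hypothesis htau : faithful_tracial_state tau.

Definition mxtau n (M : 'M[A]_n) : R[i] := \sum_i tau (M i i).

Lemma mxtau_mulC m n (M : 'M[A]_(m, n)) (N : 'M[A]_(n, m)) :
  mxtau (M *m N) = mxtau (N *m M).
Proof.
rewrite /mxtau; under eq_bigr do rewrite mxE linear_sum.
under [RHS]eq_bigr do rewrite mxE linear_sum.
rewrite exchange_big; apply: eq_bigr => i _; apply: eq_bigr => j _ /=.
exact: state_trace.
Qed.

Lemma mxstateE d (M : 'M[A]_d) : mxstate tau M = d%:R^-1 * mxtau M.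
Proof. by []. Qed.

Lemma mxtauE d (M : 'M[A]_d) : (0 < d)%N -> mxtau M = d%:R * mxstate tau M.
Proof. by move=> d0; rewrite mxstateE mulVKf // pnatr_eq0 -lt0n. Qed.

Lemma mxstar_mul m n k (M : 'M[A]_(m, n)) (N : 'M[A]_(n, k)) :
  mxstar (M *m N) = mxstar N *m mxstar M.
Proof.
apply/matrixP => i j; rewrite !mxE star_sum; apply: eq_bigr => l _.
by rewrite !mxE starM.
Qed.

Lemma mxstarK m n (M : 'M[A]_(m, n)) : mxstar (mxstar M) = M.
Proof. by apply/matrixP => i j; rewrite !mxE starK. Qed.

End MatrixTrace.

Section CircularFamily.
Variables (R : realType) (A : cstarAlgType R) (tau : {scalar A}).
Hypothesis htau : faithful_tracial_state tau.

Lemma circular_parts v (c : A) : circular tau v c ->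
  exists kappa : R, exists s : bool -> A,
  [/\ forall b, standard_semicircular tau (s b), 2 * kappa ^+ 2 = v,
      realPart c = kappa%:C *: s false & imaginaryPart c = kappa%:C *: s true].
Proof.
case=> v0 [s [hs _ ->]]; exists (Num.sqrt v / Num.sqrt 2), s.
have sc (z : R) : ((z%:C)^*)%C = z%:C by rewrite /= oppr0.
have si : (('i%C : R[i])^*)%C = - 'i%C by apply/eqP;
  rewrite eq_complex /= oppr0 !eqxx.
have i0 : (2 * 'i%C : R[i]) != 0.
  by rewrite mulf_neq0 ?pnatr_eq0 // eq_complex /= oner_eq0 andbF.
have dbl (x : A) : x + x = (2 : R[i]) *: x by rewrite scaler_nat mulr2n.
set kappa := Num.sqrt v / Num.sqrt 2.
have e : star (kappa%:C *: (s false + 'i%C *: s true)) =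
    kappa%:C *: (s false - 'i%C *: s true).
  by rewrite starZ starD starZ sc si scaleNr !(proj1 (hs _)).
split=> //.
- by rewrite /kappa expr_div_n !sqr_sqrtr // ?ltW // mulrC divfK // pnatr_eq0.
- rewrite /realPart e -scalerDr addrACA subrr addr0 scalerA mulrC -scalerA.
  by rewrite dbl [2^-1 *: _]scalerA mulVf ?pnatr_eq0 // scale1r.
- rewrite /imaginaryPart e -scalerBr opprB [s false + _]addrC addrACA subrr
    addr0 scalerA mulrC.
  by rewrite -scalerA dbl !scalerA -!mulrA mulVf // mulr1.
Qed.

Lemma semicircular_moments (s : A) : standard_semicircular tau s ->
  forall n, tau (s ^+ n.+1) = \sum_(a < n) tau (s ^+ (n.-1 - a)) * tau (s ^+ a).
Proof.
case=> _ [mu [[_ hs] hmu]] n.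
have := @catalan_convolution R[i] (fun k => tau (s ^+ k)) _ _ n; apply.
  by rewrite expr0 (state1 htau).
move=> k /=; rewrite !hs.
have := semicircle_moment_recurrence hmu k => /(congr1 (real_complex R)).
by rewrite !rmorphM /= !rmorph_nat.
Qed.

Variables (p d : nat) (C : 'M[A]_(p, d)).
Hypothesis d_gt0 : (0 < d)%N.
Hypothesis hC : star_free_circular tau (fun ij : 'I_p * 'I_d => C ij.1 ij.2).
Hypothesis hC1 : forall i j, tau (star (C i j) * C i j) = d%:R^-1.

Definition circ_part (jb : 'I_p * 'I_d * bool) : A :=
  if jb.2 then imaginaryPart (C jb.1.1 jb.1.2) else realPart (C jb.1.1 jb.1.2).
Arguments circ_part : simpl never.

Lemma partsE i j :
  C i j = circ_part (i, j, false) + 'i%C *: circ_part (i, j, true).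
Proof.
rewrite /circ_part /realPart /imaginaryPart /= scalerA.
have i0 : ('i%C : R[i]) != 0 by rewrite eq_complex /= oner_eq0 andbF.
rewrite invfM mulrCA mulfV // mulr1 -scalerDr addrACA subrr addr0.
have -> : C i j + C i j = (2 : R[i]) *: C i j by rewrite scaler_nat mulr2n.
by rewrite scalerA mulVf ?pnatr_eq0 // scale1r.
Qed.

Lemma star_partsE i j :
  star (C i j) = circ_part (i, j, false) - 'i%C *: circ_part (i, j, true).
Proof.
rewrite /circ_part /realPart /imaginaryPart /= scalerA.
have i0 : ('i%C : R[i]) != 0 by rewrite eq_complex /= oner_eq0 andbF.
rewrite invfM mulrCA mulfV // mulr1 -scalerBr opprB [C i j + _]addrC addrACA
  subrr addr0.
have -> : star (C i j) + star (C i j) = (2 : R[i]) *: star (C i j).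
  by rewrite scaler_nat mulr2n.
by rewrite scalerA mulVf ?pnatr_eq0 // scale1r.
Qed.

(** The variance is existential in the definition of a circular family. It is recovered from the
    value 1/d of tau(C^* C), where the mixed terms cancel by traciality and the two parts contribute
    equally. *)
Lemma circ_part_moments jb n : tau (circ_part jb ^+ n.+1) =
  (2 * d%:R)^-1 *
  \sum_(a < n) tau (circ_part jb ^+ (n.-1 - a)) * tau (circ_part jb ^+ a).
Proof.
case: jb => [[i j] b]; have [v hv] := proj1 hC (i, j).
have [kappa [s [hs hk hre him]]] := circular_parts hv.
have sE b' : circ_part (i, j, b') = kappa%:C *: s b' by case: b'.
have m2 b' : tau (s b' * s b') = 1.
  have := semicircular_moments (hs b') 1.
  by rewrite expr2 big_ord1 subnn expr0 (state1 htau) mulr1.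
have hkap : kappa%:C ^+ 2 = (2 * d%:R)^-1 :> R[i].
  have i2 : 'i%C * 'i%C = -1 :> R[i] by rewrite -expr2 sqr_i.
  have ty b' : tau (circ_part (i, j, b') * circ_part (i, j, b')) =
      kappa%:C ^+ 2.
    by rewrite sE -scalerAl -scalerAr !linearZ /= m2 mulr1 -expr2.
  have gen (u w : A) :
      tau ((u - 'i%C *: w) * (u + 'i%C *: w)) = tau (u * u) + tau (w * w).
    have -> : (u - 'i%C *: w) * (u + 'i%C *: w) =
        u * u + w * w + 'i%C *: (u * w - w * u).
      rewrite mulrBl !mulrDr -!scalerAl -!scalerAr scalerA i2 scaleN1r scalerBr.
      by rewrite opprB -!addrA; congr (_ + _); rewrite addrCA.
    rewrite linearD linearZ linearB /= (state_trace htau w) subrr mulr0 addr0.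
    exact: linearD.
  move: (hC1 i j); rewrite star_partsE partsE gen !ty => h.
  rewrite invfM -h mulrDr -mulrDl (_ : 2^-1 + 2^-1 = 1) ?mul1r //.
  by rewrite -div1r -mulrDl divff // pnatr_eq0.
rewrite !sE !exprZn linearZ /= (semicircular_moments (hs b)) -hkap.
case: n => [|n]; first by rewrite !big_ord0 !mulr0.
rewrite !mulr_sumr; apply: eq_bigr => a _ /=.
rewrite !exprZn !linearZ /= [X in _ = _ * X]mulrACA -exprD subnK; last first.
  by rewrite -ltnS.
by rewrite [RHS]mulrA -exprD.
Qed.

(* D i j combines the derivatives along Re C_ij and Im C_ij so as to kill every
   C_kl and to see only C_ij^*. *)
Definition circ_poly (a : A) (D : 'I_p -> 'I_d -> A -> A) : Prop :=
  exists2 da, ncpoly tau circ_part a da &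
  forall i j z, D i j z = da (i, j, false) z + 'i%C *: da (i, j, true) z.

Lemma circ_stein a D i j : circ_poly a D ->
  tau (C i j * a) = (2 * d%:R)^-1 * tau (D i j 1).
Proof.
case=> da ha hD;
  have sd jb : tau (circ_part jb * a) = (2 * d%:R)^-1 * tau (da jb 1).
  exact: (free_schwinger_dyson (state1 htau) (proj2 hC) circ_part_moments).
have -> : C i j * a = circ_part (i, j, false) * a +
    'i%C *: (circ_part (i, j, true) * a).
  by rewrite partsE mulrDl scalerAl.
rewrite linearD linearZ hD linearD linearZ.
by rewrite /= !sd mulrDr; congr (_ + _); rewrite mulrCA.
Qed.

Lemma circ_poly_ext a b D E : circ_poly a D -> a = b ->
  (forall i j z, E i j z = D i j z) -> circ_poly b E.
Proof. by case=> da ha hD <- hE; exists da => // i j z; rewrite hE hD. Qed.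

Lemma circ_poly_const c : circ_poly c%:A (fun _ _ _ => 0).
Proof.
exists (fun _ _ => 0); first exact: Ncpoly_const.
by move=> *; rewrite scaler0 addr0.
Qed.

Lemma circ_polyD a b D E : circ_poly a D -> circ_poly b E ->
  circ_poly (a + b) (fun i j z => D i j z + E i j z).
Proof.
case=> da ha hD [db hb hE]; exists (fun i z => da i z + db i z).
  exact: Ncpoly_add.
by move=> i j z; rewrite hD hE scalerDr addrACA.
Qed.

Lemma circ_polyM a b D E : circ_poly a D -> circ_poly b E ->
  circ_poly (a * b) (fun i j z => a * E i j z + D i j (b * z)).
Proof.
case=> da ha hD [db hb hE]; exists (fun i z => a * db i z + da i (b * z)).
  exact: Ncpoly_mul.
by move=> i j z; rewrite hD hE mulrDr -scalerAr scalerDr addrACA.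
Qed.

Lemma circ_polyZ c a D : circ_poly a D ->
  circ_poly (c *: a) (fun i j z => c *: D i j z).
Proof.
move=> ha; apply: circ_poly_ext (circ_polyM (circ_poly_const c) ha) _ _.
  by rewrite -scalerAl mul1r.
by move=> i j z; rewrite addr0 -scalerAl mul1r.
Qed.

Lemma circ_poly_sum (I : Type) (r : seq I) (a : I -> A) D :
  (forall i, circ_poly (a i) (D i)) ->
  circ_poly (\sum_(k <- r) a k) (fun i j z => \sum_(k <- r) D k i j z).
Proof.
move=> h; elim: r => [|k r IH].
  apply: circ_poly_ext (circ_poly_const 0) _ _ => [|i j z].
    by rewrite big_nil scale0r.
  by rewrite big_nil.
apply: circ_poly_ext (circ_polyD (h k) IH) _ _ => [|i j z]; by rewrite big_cons.
Qed.

Lemma circ_poly_C k l : circ_poly (C k l) (fun _ _ _ => 0).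
Proof.
have hv b : circ_poly (circ_part (k, l, b)) (fun i j z =>
    if (i == k) && (j == l) then (if b then 'i%C else 1) *: (tau z)%:A else 0).
  exists (fun jb z => if jb == (k, l, b) then (tau z)%:A else 0).
    exact: Ncpoly_var.
  move=> i j z; rewrite /= !xpair_eqE.
  by case: b (i == k) (j == l) => [] [] [] //=;
    rewrite ?scale1r ?scaler0 ?add0r ?addr0.
apply: circ_poly_ext (circ_polyD (hv false) (circ_polyZ 'i%C (hv true))) _ _.
  by rewrite -partsE.
move=> i j z; case: ifP => _; last by rewrite scaler0 addr0.
by rewrite scale1r !scalerA -expr2 sqr_i mulN1r scaleNr subrr.
Qed.

(** Here 1 - i * i = 2, against 1 + i * i = 0 for [C k l]; the 2 cancels the one in the variance
    1/(2d) of the parts. *)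
Lemma circ_poly_Cstar k l : circ_poly (star (C k l)) (fun i j z =>
  if (i == k) && (j == l) then (2 * tau z)%:A else 0).
Proof.
have hv b : circ_poly (circ_part (k, l, b)) (fun i j z =>
    if (i == k) && (j == l) then (if b then 'i%C else 1) *: (tau z)%:A else 0).
  exists (fun jb z => if jb == (k, l, b) then (tau z)%:A else 0).
    exact: Ncpoly_var.
  move=> i j z; rewrite /= !xpair_eqE.
  by case: b (i == k) (j == l) => [] [] [] //=;
    rewrite ?scale1r ?scaler0 ?add0r ?addr0.
apply: circ_poly_ext (circ_polyD (hv false) (circ_polyZ (- 'i%C) (hv true))) _
  _.
  by rewrite star_partsE scaleNr.
move=> i j z; case: ifP => _; last by rewrite scaler0 addr0.
by rewrite scale1r !scalerA mulNr -expr2 sqr_i opprK mul1r -scalerDl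
  mulr2n mulrDl mul1r.
Qed.

Variables (B : 'M[R[i]]_(p, d)) (s : R).

Definition X_SPN : 'M[A]_(p, d) :=
  \matrix_(i, j) ((B i j)%:A + s%:C *: C i j).

Local Notation X := X_SPN.
Local Notation W := (W_SPN C B s).

Lemma W_SPN_E : W = mxstar X *m X.
Proof. by []. Qed.

Lemma circ_poly_X i j : circ_poly (X i j) (fun _ _ _ => 0).
Proof.
rewrite mxE; apply: circ_poly_ext
  (circ_polyD (circ_poly_const _) (circ_polyZ s%:C (circ_poly_C i j))) _ _ =>
    //.
by move=> *; rewrite scaler0 addr0.
Qed.

Lemma circ_poly_Xstar j i : circ_poly (mxstar X j i) (fun k l z =>
  if (k == i) && (l == j) then (2 * s%:C * tau z)%:A else 0).
Proof.
have cs : ((s%:C)^*)%C = s%:C by rewrite /= oppr0.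
rewrite !mxE starD star_alg starZ cs; apply: circ_poly_ext (circ_polyD
  (circ_poly_const _) (circ_polyZ s%:C (circ_poly_Cstar i j))) _ _ => //.
move=> k l z; case: ifP => _; last by rewrite scaler0 addr0.
by rewrite add0r scalerA mulrCA mulrA.
Qed.

Lemma circ_poly_W q j : circ_poly (W q j) (fun k l z =>
  if l == q then (2 * s%:C * tau (X k j * z))%:A else 0).
Proof.
rewrite W_SPN_E mxE; apply: circ_poly_ext (circ_poly_sum _ (fun i =>
  circ_polyM (circ_poly_Xstar q i) (circ_poly_X i j))) _ _ => // k l z.
rewrite (bigD1 k) //= eqxx big1 => [|i /negPf ik].
  by rewrite mulr0 add0r addr0; case: eqP.
by rewrite eq_sym ik mulr0 addr0.
Qed.

(** The a-th summand cuts the word at the X^* that follows [W ^+ a]; the rest, X W^(n-1-a), goes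
    under the trace. *)
Lemma circ_poly_Wpow n q r : circ_poly ((W ^+ n) q r) (fun k l z =>
  \sum_(a < n) (2 * s%:C * tau ((X *m W ^+ (n.-1 - a)) k r * z)) *:
    (W ^+ a) q l).
Proof.
elim: n q r => [|n IH] q r.
  rewrite expr0 mxE; apply: circ_poly_ext (circ_poly_const (q == r)%:R) _ _.
    by rewrite scaler_nat.
  by move=> *; rewrite big_ord0.
rewrite exprS mxE; apply: circ_poly_ext (circ_poly_sum _ (fun j =>
  circ_polyM (circ_poly_W q j) (IH j r))) _ _ => // k l z.
rewrite big_ord_recl /= subn0 big_split /= addrC; congr (_ + _).
- have -> : (W ^+ 0) q l = (q == l)%:R by rewrite expr0 mxE.
  rewrite eq_sym; case: eqVneq => _; last by rewrite big1 // scaler0.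
  rewrite -scaler_suml -mulr_sumr -linear_sum /=.
  congr (( _ * tau _) *: _); rewrite [(X *m _) _ _]mxE mulr_suml.
  by apply: eq_bigr => j _; rewrite mulrA.
- under [RHS]eq_bigr do rewrite mulr_sumr.
  rewrite exchange_big; apply: eq_bigr => a _ /=.
  have -> : (W ^+ bump 0 a) q l = \sum_j W q j * (W ^+ a) j l.
    by rewrite /bump add1n exprS mxE.
  rewrite scaler_sumr /bump add1n subnS predn_sub.
  by apply: eq_bigr => j _; rewrite scalerAr.
Qed.

Definition moment n : R[i] := mxstate tau (W ^+ n).

(* The trace of (X X^* )^n normalised by 1/d: the two sides differ only at
   n = 0. *)
Definition comoment n : R[i] := if n == 0%N then p%:R / d%:R else moment n.

Lemma mxtau_comoment n :
  mxtau tau (X *m W ^+ n *m mxstar X) = d%:R * moment n.+1.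
Proof.
by rewrite -mulmxA (mxtau_mulC htau) -mulmxA -W_SPN_E mulmxE -exprSr mxtauE.
Qed.

(** The cut at the final X^* leaves an empty word of size p, whence [comoment 0]; every other cut
    splits the trace into one of X W^(n-1-a) X^* and one of W^a. *)
Lemma moment_stein n :
  d%:R^-1 * mxtau tau (C *m (W ^+ n *m mxstar X)) =
  s%:C * \sum_(a < n.+1) comoment (n - a)%N * moment a.
Proof.
have d0 : (d%:R : R[i]) != 0 by rewrite pnatr_eq0 -lt0n.
have st k q : tau (C k q * (W ^+ n *m mxstar X) q k) = s%:C * d%:R^-1 *
    (tau ((W ^+ n) q q) + \sum_(a < n)
       tau ((X *m W ^+ (n.-1 - a) *m mxstar X) k k) * tau ((W ^+ a) q q)).
  have h : circ_poly ((W ^+ n *m mxstar X) q k) (fun i j z => \sum_r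
      ((W ^+ n) q r * (if (i == k) && (j == r) then (2 * s%:C * tau z)%:A else
        0) +
      \sum_(a < n) (2 * s%:C * tau ((X *m W ^+ (n.-1 - a)) i r *
        (mxstar X r k * z))) *: (W ^+ a) q j)).
    rewrite mxE; apply: circ_poly_ext (circ_poly_sum _ (fun r =>
      circ_polyM (circ_poly_Wpow n q r) (circ_poly_Xstar r k))) _ _ => //.
  rewrite (circ_stein _ _ h) big_split /= (bigD1 q) //= !eqxx big1; last first.
    by move=> r /negPf rq; rewrite eq_sym rq mulr0.
  rewrite (state1 htau) mulr1 addr0 -scalerAr mulr1 linearD linearZ /=.
  rewrite exchange_big linear_sum /=.
  have -> : \sum_(a < n) tau (\sum_r (2 * s%:C * tau ((X *m W ^+ (n.-1 - a)) k
    r *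
      (mxstar X r k * 1))) *: (W ^+ a) q q) = 2 * s%:C * \sum_(a < n)
       tau ((X *m W ^+ (n.-1 - a) *m mxstar X) k k) * tau ((W ^+ a) q q).
    rewrite mulr_sumr; apply: eq_bigr => a _.
    rewrite -scaler_suml linearZ /= -mulr_sumr -linear_sum mulrA /=.
    congr (_ * tau _ * _); rewrite [RHS]mxE.
    by apply: eq_bigr => r _; rewrite mulr1.
  rewrite -mulrDr mulrA; congr (_ * _).
  by rewrite invfM mulrACA mulVf ?pnatr_eq0 // mul1r mulrC.
have -> : mxtau tau (C *m (W ^+ n *m mxstar X)) =
    \sum_k \sum_q s%:C * d%:R^-1 * (tau ((W ^+ n) q q) + \sum_(a < n)
       tau ((X *m W ^+ (n.-1 - a) *m mxstar X) k k) * tau ((W ^+ a) q q)).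
  apply: eq_bigr => k _; rewrite mxE linear_sum; apply: eq_bigr => q _.
  exact: st.
have -> : \sum_k \sum_q s%:C * d%:R^-1 * (tau ((W ^+ n) q q) + \sum_(a < n)
       tau ((X *m W ^+ (n.-1 - a) *m mxstar X) k k) * tau ((W ^+ a) q q)) =
   s%:C * d%:R^-1 * (p%:R * (d%:R * moment n) + \sum_(a < n)
     (d%:R * moment (n - a)%N) * (d%:R * moment a)).
  under eq_bigr do rewrite -mulr_sumr big_split /=.
  rewrite -mulr_sumr big_split /= sumr_const card_ord -[_ *+ p]mulr_natl.
  rewrite -[\sum_(i < d) tau _]/(mxtau tau (W ^+ n)) mxtauE //.
  congr (_ * (_ + _)); under eq_bigr do rewrite exchange_big.
  rewrite exchange_big; apply: eq_bigr => a _ /=.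
  under eq_bigr do rewrite -mulr_sumr.
  rewrite -mulr_suml -[\sum_(i < d) tau _]/(mxtau tau (W ^+ a)) mxtauE //.
  rewrite -[\sum_(i < p) tau _]/(mxtau tau _) mxtau_comoment.
  by rewrite -subSn ?prednK ?(leq_ltn_trans _ (ltn_ord a)) // -ltnS prednK
    ?(leq_ltn_trans _ (ltn_ord a)).
rewrite -mulrA mulrCA; congr (_ * _).
rewrite big_ord_recr /= subnn /= addrC !mulrDr; congr (_ + _).
  by rewrite /comoment [p%:R * _]mulrCA mulKf // mulrA [p%:R / _]mulrC.
rewrite !mulr_sumr; apply: eq_bigr => a _.
have -> : comoment (n - a)%N = moment (n - a)%N.
  by rewrite /comoment subn_eq0 leqNgt ltn_ord.
by rewrite [d%:R * _ * _]mulrACA -[d%:R * d%:R * _]mulrA !mulKf.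
Qed.

End CircularFamily.

(** * The moment flow *)

Section MomentFlow.
Variables (F : numFieldType) (lam : F).
Implicit Types (G H : nat -> {poly F}) (w q : {poly F}).

Definition flow_field G k : {poly F} := k%:R *: \sum_(a < k)
  (if (k.-1 - a == 0)%N then lam%:P else G (k.-1 - a)%N) * G a.

Lemma eq_flow_field G H k : (forall a, (a < k)%N -> G a = H a) ->
  flow_field G k = flow_field H k.
Proof.
move=> e; congr (_ *: _); apply: eq_bigr => a _; rewrite !e //.
by rewrite (leq_ltn_trans (leq_subr _ _)) // prednK // (leq_ltn_trans _
  (ltn_ord a)).
Qed.

Lemma comp_flow_field G k q :
  flow_field G k \Po q = flow_field (fun a => G a \Po q) k.
Proof.
rewrite /flow_field comp_polyZ raddf_sum; congr (_ *: _).
apply: eq_bigr => a _; rewrite /= comp_polyM; congr (_ * _).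
by case: ifP; rewrite // comp_polyC.
Qed.

Lemma deriv_eq0_horner q t : q^`() = 0 -> q.[t] = 0 -> q = 0.
Proof.
move=> dq; have e : q = (q`_0)%:P.
  apply/polyP => -[|n]; rewrite coefC //=.
  have := congr1 (fun r : {poly F} => r`_n) dq.
  by rewrite coef_deriv coef0 => /eqP; rewrite mulrn_eq0 => /= /eqP.
by rewrite e hornerC => ->; rewrite polyC0.
Qed.

(** The system is triangular, and in characteristic zero a polynomial is determined by its
    derivative and one value. The weight [w] is 2X in the variable s and 1 in the variable s^2. *)
Lemma flow_unique w G H t :
  (forall k, (G k)^`() = w * flow_field G k) ->
  (forall k, (H k)^`() = w * flow_field H k) ->
  (forall k, (G k).[t] = (H k).[t]) -> G =1 H.
Proof.
move=> dG dH e k; have [n] := ubnP k; elim: n k => // n IH k le_k.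
apply/eqP; rewrite -subr_eq0; apply/eqP; apply: (@deriv_eq0_horner _ t).
  rewrite derivB dG dH (@eq_flow_field G H) ?subrr // => a lt_a.
  by apply: IH; rewrite (leq_trans lt_a) // -ltnS.
by rewrite hornerD hornerN e subrr.
Qed.

Lemma flow_shift G c : (forall k, (G k)^`() = flow_field G k) ->
  forall k, (G k \Po ('X + c%:P))^`() = flow_field (fun a => G a \Po ('X +
    c%:P)) k.
Proof.
by move=> dG k; rewrite deriv_comp dG comp_flow_field derivD derivX derivC addr0
  mulr1.
Qed.

(* With t = s^2 the weight 2 s of the flow disappears. *)
Lemma flow_sqrt G : (forall k, (G k)^`() = (2%:P * 'X) * flow_field G k) ->
  exists2 H, forall k, G k = H k \Po 'X^2 &
             forall k, (H k)^`() = flow_field H k.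
Proof.
move=> dG.
(* G(-X) solves the same flow, the two signs cancelling, and has the same value at 0; hence each
   [G k] is even. *)
have sym : (fun k => G k \Po - 'X) =1 G.
  apply: (@flow_unique (2%:P * 'X) _ _ 0) => // k.
    rewrite deriv_comp dG comp_polyM comp_flow_field derivN derivX comp_polyM.
    by rewrite comp_polyC comp_polyX mulrN1 mulrN mulNr opprK.
  by rewrite horner_comp hornerN hornerX oppr0.
have ev k : G k = even_poly (G k) \Po 'X^2.
  rewrite -[LHS]poly_even_odd (_ : odd_poly (G k) = 0).
    by rewrite comp_poly0 mul0r addr0.
  apply/polyP => i; rewrite coef_odd_poly coef0.
  have := congr1 (fun r : {poly F} => r`_(i.*2.+1)) (sym k).
  rewrite /= -scaleN1r.
  have -> : (G k \Po (-1 *: 'X))`_(i.*2.+1) = - (G k)`_(i.*2.+1).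
    have -> : G k \Po (-1 *: 'X) =
        \poly_(l < size (G k)) ((G k)`_l * (-1) ^+ l).
      rewrite comp_polyE poly_def; apply: eq_bigr => l _.
      by rewrite exprZn scalerA.
    rewrite coef_poly -signr_odd /= odd_double mulrN1.
    by case: ltnP => // /(nth_default 0) ->; rewrite oppr0.
  by move/eqP; rewrite -subr_eq0 -opprD oppr_eq0 -mulr2n mulrn_eq0 => /eqP.
exists (fun k => even_poly (G k)) => // k.
have X0 : (2%:P * 'X : {poly F}) != 0.
  by rewrite mulf_neq0 ?polyX_eq0 // polyC_eq0 pnatr_eq0.
(* Composition with X^2 is injective, so the equation may be tested after it, where 2X cancels. *)
apply/eqP; rewrite -subr_eq0.
rewrite -(@comp_poly_eq0 _ _ 'X^2) ?size_polyXn //.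
rewrite comp_polyB subr_eq0; apply/eqP; apply: (mulfI X0).
rewrite comp_flow_field -(eq_flow_field (G := G)); last by move=> a _;
  exact: ev.
rewrite -dG [in RHS]ev deriv_comp derivXn /= mulrC; congr (_ * _).
by rewrite mul_polyC scaler_nat expr1.
Qed.

End MomentFlow.

Section StateReal.
Variables (R : realType) (A : cstarAlgType R) (tau : {scalar A}).
Hypothesis htau : faithful_tracial_state tau.

Lemma Im_ge0 (z : R[i]) : 0 <= z -> complex.Im z = 0.
Proof. by case: z => a b; rewrite lecE /= => /andP[/eqP ->]. Qed.

(* Polarization: tau is positive on (x + 1)^*(x + 1) and (x + i)^*(x + i). *)
Lemma tau_star (x : A) : tau (star x) = ((tau x)^*)%C.
Proof.
have e (z : R[i]) : complex.Im (z * tau (star x) + (z^*)%C * tau x) = 0.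
  have h := Im_ge0 (state_ge0 htau (x + z%:A)).
  have h1 := Im_ge0 (state_ge0 htau x).
  move: h; rewrite starD star_alg mulrDl !mulrDr -!scalerAl -!scalerAr !mul1r
    !mulr1.
  rewrite !linearD !linearZ /= (state1 htau) mulr1.
  rewrite h1 add0r.
  have -> : complex.Im ((z^*)%C * z) = 0 by case: z => a b /=; ring.
  by rewrite addr0.
have := e 1; have := e 'i%C; case: (tau x) (tau (star x)) => a b [c f] /=.
move=> h1 h2.
by apply/eqP; rewrite eq_complex /=; apply/andP; split; apply/eqP; lra.
Qed.

Lemma mxtau_star n (M : 'M[A]_n) : mxtau tau (mxstar M) = ((mxtau tau M)^*)%C.
Proof.
rewrite /mxtau rmorph_sum; apply: eq_bigr => i _.
by rewrite mxE tau_star.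
Qed.

Lemma mxstar_exp n (M : 'M[A]_n) k : mxstar (M ^+ k) = (mxstar M) ^+ k.
Proof.
elim: k => [|k IH].
  apply/matrixP => i j; rewrite !expr0 !mxE eq_sym.
  by case: eqP; rewrite ?star1 ?star0.
by rewrite exprS exprSr -IH -!mulmxE mxstar_mul.
Qed.

End StateReal.

(** * The moments as polynomials in s *)

Section MomentPolynomial.
Variables (R : realType) (A : cstarAlgType R) (tau : {scalar A}).
Hypothesis htau : faithful_tracial_state tau.
Variables (p d : nat) (C : 'M[A]_(p, d)).
Hypothesis d_gt0 : (0 < d)%N.
Hypothesis hC : star_free_circular tau (fun ij : 'I_p * 'I_d => C ij.1 ij.2).
Hypothesis hC1 : forall i j, tau (star (C i j) * C i j) = d%:R^-1.
Variable B : 'M[R[i]]_(p, d).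

Lemma mxstar_W s n : mxstar (W_SPN C B s ^+ n) = W_SPN C B s ^+ n.
Proof. by rewrite mxstar_exp W_SPN_E mxstar_mul mxstarK. Qed.

Lemma moment_real s n : ((moment tau C B s n)^*)%C = moment tau C B s n.
Proof.
rewrite /moment mxstateE rmorphM /= -(mxtau_star htau) mxstar_W.
by rewrite fmorphV rmorph_nat.
Qed.

Lemma comoment_real s n : ((comoment tau C B s n)^*)%C = comoment tau C B s n.
Proof.
rewrite /comoment; case: ifP => _; last exact: moment_real.
by rewrite rmorphM fmorphV !rmorph_nat.
Qed.

(** The indeterminate stands for s, which makes differentiation in s algebraic. Coefficients do not
    commute, but only scalars are substituted, and these are central, so evaluation is
    multiplicative. *)
Definition X_poly : 'M[{poly A}]_(p, d) :=
  \matrix_(i, j) (((B i j)%:A)%:P + (C i j)%:P * 'X).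

Definition Xstar_poly : 'M[{poly A}]_(d, p) :=
  \matrix_(j, i) ((((B i j)^*)%C%:A)%:P + (star (C i j))%:P * 'X).

Definition W_poly : 'M[{poly A}]_d := Xstar_poly *m X_poly.

Definition mxhorner m n (s : R) (M : 'M[{poly A}]_(m, n)) : 'M[A]_(m, n) :=
  \matrix_(i, j) (M i j).[(s%:C)%:A].

Definition mxderiv m n (M : 'M[{poly A}]_(m, n)) : 'M[{poly A}]_(m, n) :=
  \matrix_(i, j) (M i j)^`().

Lemma comm_poly_scalar (q : {poly A}) (z : R[i]) : comm_poly q (z%:A).
Proof. by rewrite /comm_poly -scalerAl mul1r -scalerAr mulr1. Qed.

Lemma mxhornerM m n k s (M : 'M[_]_(m, n)) (N : 'M[_]_(n, k)) :
  mxhorner s (M *m N) = mxhorner s M *m mxhorner s N.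
Proof.
apply/matrixP => i j; rewrite !mxE horner_sum; apply: eq_bigr => l _.
by rewrite !mxE hornerM_comm //; exact: comm_poly_scalar.
Qed.

Lemma mxhornerD m n s (M N : 'M[_]_(m, n)) :
  mxhorner s (M + N) = mxhorner s M + mxhorner s N.
Proof. by apply/matrixP => i j; rewrite !mxE hornerD. Qed.

Lemma mxhorner_X s : mxhorner s X_poly = X_SPN C B s.
Proof.
apply/matrixP => i j; rewrite !mxE hornerD hornerC hornerM_comm; last first.
  exact: comm_poly_scalar.
by rewrite hornerC hornerX -scalerAr mulr1.
Qed.

Lemma mxhorner_Xstar s : mxhorner s Xstar_poly = mxstar (X_SPN C B s).
Proof.
have cs : ((s%:C)^*)%C = s%:C by rewrite /= oppr0.
apply/matrixP => i j; rewrite !mxE hornerD hornerC hornerM_comm; last first.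
  exact: comm_poly_scalar.
by rewrite hornerC hornerX -scalerAr mulr1 starD star_alg starZ cs.
Qed.

Lemma mxhorner_W s n : mxhorner s (W_poly ^+ n) = W_SPN C B s ^+ n.
Proof.
elim: n => [|n IH].
  by apply/matrixP => i j; rewrite !expr0 !mxE; case: eqP; rewrite ?hornerC.
by rewrite !exprS -!mulmxE mxhornerM IH mxhornerM mxhorner_X mxhorner_Xstar.
Qed.

Lemma mxderivM m n k (M : 'M[_]_(m, n)) (N : 'M[_]_(n, k)) :
  mxderiv (M *m N) = mxderiv M *m N + M *m mxderiv N.
Proof.
apply/matrixP => i j; rewrite !mxE (raddf_sum (@deriv A)) -big_split.
apply: eq_bigr => l _ /=; rewrite [mxderiv M _ _]mxE [mxderiv N _ _]mxE.
exact: derivM.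
Qed.

Lemma mxhorner_derivW s : mxhorner s (mxderiv W_poly) =
  mxstar C *m X_SPN C B s + mxstar (X_SPN C B s) *m C.
Proof.
rewrite mxderivM mxhornerD !mxhornerM mxhorner_X mxhorner_Xstar.
have -> : mxhorner s (mxderiv X_poly) = C.
  apply/matrixP => i j.
  by rewrite !mxE derivD derivC add0r deriv_mulC derivX mulr1 hornerC.
have -> // : mxhorner s (mxderiv Xstar_poly) = mxstar C.
apply/matrixP => i j.
by rewrite !mxE derivD derivC add0r deriv_mulC derivX mulr1 hornerC.
Qed.

(** By cyclicity of the trace each of the n factors contributes the same; [W ^+ m] collects the
    factors already moved around during the induction. *)
Lemma mxtau_derivW s n m :
  mxtau tau (mxhorner s (mxderiv (W_poly ^+ n)) *m W_SPN C B s ^+ m) =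
  n%:R * mxtau tau (mxhorner s (mxderiv W_poly) *m W_SPN C B s ^+ (n.-1 + m)).
Proof.
elim: n m => [|n IH] m.
  rewrite mul0r expr0 (_ : mxhorner _ _ = 0) ?mul0mx; last first.
    by apply/matrixP => i j; rewrite !mxE; case: eqP; rewrite ?derivC horner0.
  by rewrite /mxtau big1 // => i _; rewrite mxE linear0.
have hW : mxhorner s W_poly = W_SPN C B s by rewrite -[W_poly]expr1 mxhorner_W.
have mD (M N : 'M[A]_d) : mxtau tau (M + N) = mxtau tau M + mxtau tau N.
  by rewrite /mxtau -big_split; apply: eq_bigr => i _; rewrite mxE linearD.
rewrite exprS -mulmxE mxderivM mxhornerD (mxhornerM s (mxderiv W_poly)).
rewrite (mxhornerM s W_poly) hW mxhorner_W mulmxDl mD.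
set D := mxhorner s (mxderiv W_poly);
  set E := mxhorner s (mxderiv (W_poly ^+ n)).
have -> : D *m W_SPN C B s ^+ n *m W_SPN C B s ^+ m =
    D *m W_SPN C B s ^+ (n + m) by rewrite -mulmxA !mulmxE exprD.
have -> : mxtau tau (W_SPN C B s *m E *m W_SPN C B s ^+ m) =
    mxtau tau (E *m W_SPN C B s ^+ m.+1).
  by rewrite -mulmxA (mxtau_mulC htau) -mulmxA !mulmxE exprSr.
rewrite IH -natr1 mulrDl mul1r addrC; congr (_ + _).
case: n {IH E} => [|n]; first by rewrite !mul0r.
by rewrite /= addnS.
Qed.

Definition moment_poly n : {poly R[i]} :=
  d%:R^-1 *: map_poly tau (\sum_i (W_poly ^+ n) i i).

Lemma horner_map_tau (q : {poly A}) (z : R[i]) :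
  (map_poly tau q).[z] = tau q.[z%:A].
Proof.
rewrite (@horner_coef_wide _ (size q)) ?size_poly // horner_coef linear_sum.
apply: eq_bigr => k _; rewrite coef_map exprZn expr1n -scalerAr mulr1.
by rewrite linearZ /= mulrC.
Qed.

Lemma deriv_map_tau (q : {poly A}) :
  (map_poly tau q)^`() = map_poly tau q^`().
Proof.
by apply/polyP => k; rewrite coef_deriv !coef_map coef_deriv raddfMn.
Qed.

Lemma horner_moment_poly s n :
  (moment_poly n).[s%:C] = moment tau C B s n.
Proof.
rewrite hornerZ horner_map_tau horner_sum linear_sum; congr (_ * _).
by apply: eq_bigr => i _; rewrite -mxhorner_W mxE.
Qed.

(** The derivative of W is C^* X + X^* C. The second term is given by [moment_stein], the first is
    its complex conjugate, and the two agree because the moments are real; hence the factor 2. *)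
Lemma horner_deriv_moment_poly s n : (moment_poly n)^`().[s%:C] =
  2 * s%:C * (n%:R * \sum_(a < n)
    comoment tau C B s (n.-1 - a)%N * moment tau C B s a).
Proof.
rewrite derivZ hornerZ deriv_map_tau horner_map_tau (raddf_sum (@deriv A))
  horner_sum.
rewrite linear_sum /=.
have -> : \sum_i tau (((W_poly ^+ n) i i)^`()).[(s%:C)%:A] =
    mxtau tau (mxhorner s (mxderiv (W_poly ^+ n)) *m W_SPN C B s ^+ 0).
  by rewrite expr0 mulmx1; apply: eq_bigr => i _; rewrite !mxE.
rewrite mxtau_derivW addn0 mxhorner_derivW.
case: n => [|n]; first by rewrite !mul0r !mulr0.
rewrite mulrCA [RHS]mulrCA; congr (_ * _); rewrite /= mulmxDl.
have mD (M N : 'M[A]_d) : mxtau tau (M + N) = mxtau tau M + mxtau tau N.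
  by rewrite /mxtau -big_split; apply: eq_bigr => i _; rewrite mxE linearD.
set X := X_SPN C B s; set W := W_SPN C B s.
have e1 : mxtau tau (mxstar X *m C *m W ^+ n) =
    mxtau tau (C *m (W ^+ n *m mxstar X)).
  by rewrite -mulmxA (mxtau_mulC htau) mulmxA.
have e2 : mxtau tau (mxstar C *m X *m W ^+ n) =
    ((mxtau tau (C *m (W ^+ n *m mxstar X)))^*)%C.
  rewrite -(mxtau_star htau) !mxstar_mul mxstarK mxstar_W.
  by rewrite -mulmxA (mxtau_mulC htau).
have cs : ((s%:C)^*)%C = s%:C by rewrite /= oppr0.
have := moment_stein htau d_gt0 hC hC1 B s n; rewrite -/X -/W => st.
rewrite mD e1 e2 mulrDr st.
have -> : d%:R^-1 * ((mxtau tau (C *m (W ^+ n *m mxstar X)))^*)%C =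
    ((d%:R^-1 * mxtau tau (C *m (W ^+ n *m mxstar X)))^*)%C.
  by rewrite rmorphM fmorphV rmorph_nat.
rewrite st; set S := \sum_(a < n.+1) _.
have -> : ((s%:C * S)^*)%C = (s%:C^*)%C * (S^*)%C by exact: rmorphM.
have -> : (S^*)%C = S.
  rewrite [LHS]rmorph_sum; apply: eq_bigr => a _; rewrite [LHS]rmorphM.
  by congr (_ * _); [exact: comoment_real|exact: moment_real].
by rewrite cs; ring.
Qed.

End MomentPolynomial.

(** * Compactly supported measures are determined by their moments *)

Section MomentDeterminacy.
Variable R : realType.

Lemma bernoulli_ge (x : R) n : 0 <= x -> x <= 1 -> 1 - n%:R * x <= (1 - x) ^+ n.
Proof.
move=> x0 x1; elim: n => [|n IH]; first by rewrite mul0r subr0 expr0.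
rewrite exprS; apply: (le_trans _ (ler_wpM2l _ IH)); last by rewrite subr_ge0.
rewrite -natr1; have : 0 <= (n%:R : R) by []. nra.
Qed.

Lemma bernoulli_le (x : R) n : 0 <= x -> x <= 1 -> (1 - x) ^+ n * (1 + n%:R *
  x) <= 1.
Proof.
move=> x0 x1; elim: n => [|n IH]; first by rewrite mul0r addr0 expr0 mulr1.
apply: le_trans IH; rewrite exprSr -mulrA ler_wpM2l ?exprn_ge0 ?subr_ge0 //.
rewrite -natr1; have : 0 <= (n%:R : R) by []. nra.
Qed.

Lemma cvg_natr_expr (z : R) : 0 <= z -> z < 1 ->
  n%:R * z ^+ n @[n --> \oo] --> (0 : R).
Proof.
(* With z = w^2, one factor w^n absorbs n by Bernoulli's inequality and the other tends to 0. *)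
move=> z0 z1; pose w := Num.sqrt z.
have w0 : 0 <= w by rewrite sqrtr_ge0.
have w1 : w < 1 by rewrite -sqrtr1 ltr_sqrt.
have zE : z = w * w by rewrite -expr2 sqr_sqrtr.
have x0 : 0 < 1 - w by rewrite subr_gt0.
have h n : n%:R * z ^+ n <= (1 - w)^-1 * w ^+ n.
  have := @bernoulli_le (1 - w) n (ltW x0);
    rewrite subKr lerBlDl lerDr => /(_ w0) h.
  have wn : 0 <= w ^+ n by rewrite exprn_ge0.
  have h2 : n%:R * w ^+ n <= (1 - w)^-1.
    by rewrite -[leRHS]mul1r ler_pdivlMr //; nra.
  by rewrite zE exprMn mulrA ler_wpM2r.
apply: (@squeeze_cvgr _ _ _ _ (cst 0) (fun n => (1 - w)^-1 * w ^+ n)).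
- by apply: nearW => n; rewrite h mulr_ge0 ?exprn_ge0.
- exact: cvg_cst.
- by apply: cvg_geometric; rewrite ger0_norm.
Qed.

(* The exponent is n 2^n rather than 2^n to make the limit at y = 1/2 equal to
  1. *)
Definition step_fun n (y : R) : R := 1 - (1 - y ^+ n) ^+ (n * 2 ^ n).

Lemma step_fun01 n (y : R) : 0 <= y <= 1 -> 0 <= step_fun n y <= 1.
Proof.
move=> /andP[y0 y1]; have y2 : 0 <= 1 - y ^+ n <= 1.
  by rewrite subr_ge0 exprn_ile1 //= lerBlDl lerDr exprn_ge0.
case/andP: y2 => y2 y3.
by rewrite /step_fun subr_ge0 exprn_ile1 //= lerBlDl lerDr exprn_ge0.
Qed.

(** By the two Bernoulli inequalities, 1 - [step_fun n y] is at most 1/(1 + n (2y)^n), and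
    [step_fun n y] is at most n (2y)^n. *)
Lemma cvg_step_fun (y : R) : 0 <= y <= 1 ->
  step_fun n y @[n --> \oo] --> ((2^-1 <= y)%R%:R : R).
Proof.
move=> y01; have /andP[y0 y1] := y01; case: leP => y2.
  apply: (@squeeze_cvgr _ _ _ _ (fun n => 1 - harmonic n) (cst 1)).
  - apply: nearW => n; have /andP[_ ->] := step_fun01 n y01.
    rewrite andbT /step_fun lerD2l lerN2 /harmonic /=.
    have x0 : 0 <= y ^+ n by rewrite exprn_ge0.
    have x1 : y ^+ n <= 1 by rewrite exprn_ile1.
    have := bernoulli_le (n * 2 ^ n) x0 x1.
    set q := (_ - _) ^+ _ => h.
    have q0 : 0 <= q by rewrite exprn_ge0 // subr_ge0.
    have e : n%:R <= ((n * 2 ^ n)%N%:R : R) * y ^+ n.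
      rewrite natrM natrX -mulrA -exprMn ler_peMr // exprn_ege1 //.
      by rewrite -ler_pdivrMl // mulr1.
    rewrite -[leRHS]mul1r -ler_pdivrMr ?invr_gt0 // invrK.
    by rewrite -natr1 addrC; apply: le_trans h; rewrite ler_wpM2l // lerD2l.
  - rewrite -[X in _ --> X]subr0; apply: cvgB; first exact: cvg_cst.
    exact: cvg_harmonic.
  - exact: cvg_cst.
have z1 : 2 * y < 1 by lra.
have z0 : 0 <= 2 * y by lra.
apply: (@squeeze_cvgr _ _ _ _ (cst 0) (fun n => n%:R * (2 * y) ^+ n)).
- apply: nearW => n; have /andP[-> _] /= := step_fun01 n y01.
  rewrite /step_fun lerBlDl -lerBlDr exprMn mulrA -natrX -natrM.
  by apply: bernoulli_ge; rewrite ?exprn_ge0 ?exprn_ile1.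
- exact: cvg_cst.
- exact: cvg_natr_expr.
Qed.

(** Polynomials converge boundedly, on a common support, to the indicator of a closed ray; dominated
    convergence gives equality on rays, a pi-system generating the Borel sets. *)
Lemma moment_determinacy (mu nu : probability (measurableTypeR R) R) (M N : R) :
  mu (~` `[- M, M]) = 0%E -> nu (~` `[- N, N]) = 0%E ->
  (forall k, \int[mu]_x x ^+ k = \int[nu]_x x ^+ k) ->
  forall U : set R, measurable U -> mu U = nu U.
Proof.
move=> hM hN hmom.
pose L := Num.max M N.
have widen (P : probability (measurableTypeR R) R) K : K <= L ->
    P (~` `[- K, K]) = 0%E -> P (~` `[- L, L]) = 0%E.
  move=> KL; apply: subset_measure0; [exact: measurableC|exact: measurableC|].
  apply: subsetC => x /=; rewrite !in_itv /= => /andP[x1 x2].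
  by rewrite (le_trans _ x1) ?lerN2 // (le_trans x2).
have {hM}hM := widen mu M _ hM; have {hN}hN := widen nu N _ hN.
have {hM}hM : mu (~` `[- L, L]) = 0%E by apply: hM; rewrite le_max lexx.
have {hN}hN : nu (~` `[- L, L]) = 0%E by apply: hN; rewrite le_max lexx orbT.
have poly_eq (q : {poly R}) : (\int[mu]_x q.[x]%:E = \int[nu]_x q.[x]%:E)%E.
  have cq : continuous (horner q) by exact: continuous_horner.
  rewrite -[LHS]fineK; last first.
    by apply: integrable_fin_num => //; exact: (continuous_integrable hM).
  rewrite -[RHS]fineK; last first.
    by apply: integrable_fin_num => //; exact: (continuous_integrable hN).
  rewrite -!/(Rintegral _ _ _) (Rintegral_poly hM) (Rintegral_poly hN).
  by congr EFin; apply: eq_bigr => k _; rewrite hmom.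
have ray (t : R) : mu `[t, +oo[%classic = nu `[t, +oo[%classic.
  (* Large enough for the affine map [l] to send [-L, L] into [0, 1], with value at least 1/2
     exactly when x >= t. *)
  pose K := 2 * (`|L| + `|t|) + 1.
  have K0 : 0 < K by rewrite /K; have := normr_ge0 L; have := normr_ge0 t; lra.
  pose l : {poly R} := K^-1 *: ('X - t%:P) + 2^-1%:P.
  pose P n : {poly R} := 1 - (1 - l ^+ n) ^+ (n * 2 ^ n).
  have lE x : l.[x] = K^-1 * (x - t) + 2^-1 by rewrite /l !hornerE.
  have PE n x : (P n).[x] = step_fun n l.[x].
    by rewrite /P /step_fun !(hornerE, horner_exp).
  have l01 x : x \in `[- L, L] -> 0 <= l.[x] <= 1.
    rewrite in_itv /= => /andP[x1 x2].
    have h : `|K^-1 * (x - t)| <= 2^-1.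
      rewrite normrM gtr0_norm ?invr_gt0 // mulrC ler_pdivrMr //.
      apply: (le_trans (ler_normB _ _)).
      have : `|x| <= `|L|.
        rewrite ler_norml (le_trans x2 (ler_norm _)) andbT.
        by apply: le_trans x1; rewrite lerN2 ler_norm.
      by rewrite /K; lra.
    by move: h; rewrite ler_norml lE; lra.
  have lim (Q : probability (measurableTypeR R) R) : Q (~` `[- L, L]) = 0%E ->
      (\int[Q]_x (P n).[x]%:E @[n --> \oo] --> Q `[t, +oo[%classic)%E.
    move=> hQ; have cP n : continuous (horner (P n)) by exact:
      continuous_horner.
    under eq_fun do rewrite (integral_segment hQ) //.
    have -> : Q `[t, +oo[%classic = (\int[Q]_(x in `[(- L)%R, L]) (\1_(`[t,
      +oo[%classic) x)%:E)%E.
      rewrite integral_indic //.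
      rewrite [LHS](measureDI Q (B := `[- L, L])) // [X in (X + _)%E](_ : _ =
        0%E).
        by rewrite add0e.
      apply: (subset_measure0 _ _ _ hQ); [exact: measurableD| |by move=> x []].
      exact: measurableC.
    have [] // := @dominated_convergence _ _ _ Q `[- L, L]%classic _
      (fun n x => (P n).[x]%:E) (fun x => (\1_(`[t, +oo[%classic) x)%:E) (cst
        1%E).
    - move=> n; apply/measurable_EFinP; apply: measurable_funTS.
      exact: continuous_measurableR.
    - apply/measurable_EFinP; exact: measurable_indic.
    - apply: aeW => x hx; apply: cvg_EFin; first exact: nearW.
      rewrite /comp /=; under eq_fun do rewrite PE.
      have -> : \1_(`[t, +oo[%classic) x = (2^-1 <= l.[x])%R%:R :> R.
        rewrite indicE; congr (_%:R : R); congr nat_of_bool.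
        rewrite lE lerDr pmulr_rge0 ?invr_gt0 // subr_ge0.
        by apply/idP/idP; rewrite inE /= in_itv /= andbT.
      exact/cvg_step_fun/l01.
    - exact: (@continuous_integrable_segment R Q L (cst 1) (@cst_continuous _ _
      _)).
    - apply: aeW => x n hx /=; rewrite lee_fin PE.
      have /andP[h0 h1] := step_fun01 n (l01 x hx).
      by rewrite ger0_norm.
  have := lim mu hM; under eq_fun do rewrite poly_eq; move=> h1.
  exact: (cvg_unique _ h1 (lim nu hN)).
pose g (n : nat) : set (measurableTypeR R) := `[- n%:R, +oo[%classic.
have GI : setI_closed (@RGenCInfty.G R).
  move=> _ _ [x ->] [y ->]; exists (Num.max x y).
  apply/seteqP; split => z /=; rewrite !in_itv /= !andbT ge_max.
    by case=> -> ->.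
  by case/andP.
have gG n : RGenCInfty.G (g n) by exists (- n%:R).
have gT : \bigcup_k g k = setT.
  apply/seteqP; split => // x _; exists (Num.bound `|x|) => //=.
  rewrite /g /= in_itv /= andbT lerNl; apply: (le_trans (ler_norm _)).
  by rewrite normrN (le_trans (ltW (archi_boundP (normr_ge0 x)))).
apply: (@measure_unique _ R (measurableTypeR R) (@RGenCInfty.G R) g
  (RGenCInfty.measurableE R) GI gG gT mu nu) => [_ [x ->]|k].
  exact: ray.
apply: (@le_lt_trans _ _ 1%E); last exact: ltry.
apply: probability_le1; rewrite /g; exact: measurable_itv.
Qed.

End MomentDeterminacy.

(** * Spectra of Gram matrices *)

Section Spectrum.
Variable R : realType.

Lemma char_poly_conj (F : fieldType) n (P D : 'M[F]_n) : P \in unitmx ->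
  char_poly (invmx P *m D *m P) = char_poly D.
Proof.
move=> uP; rewrite /char_poly /char_poly_mx !map_mxM.
set Q := map_mx _ P; set Q' := map_mx _ (invmx P).
have QQ : Q' *m Q = 1%:M by rewrite -map_mxM mulVmx // map_mx1.
have -> : 'X%:M - Q' *m map_mx polyC D *m Q = Q' *m ('X%:M - map_mx polyC D) *m
  Q.
  rewrite mulmxBr mulmxBl; congr (_ - _).
  by rewrite scalar_mxC -mulmxA QQ mulmx1.
by rewrite !det_mulmx mulrAC -det_mulmx QQ det1 mul1r.
Qed.

Lemma trace_conj_diag_exp (F : fieldType) n (P : 'M[F]_n) (v : 'rV[F]_n) k :
  P \in unitmx ->
  \tr ((invmx P *m diag_mx v *m P) ^+ k) = \sum_i v 0 i ^+ k.
Proof.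
move=> uP.
have -> : (invmx P *m diag_mx v *m P) ^+ k =
    invmx P *m diag_mx (map_mx (fun x => x ^+ k) v) *m P.
  elim: k => [|k IH].
    rewrite expr0 (_ : diag_mx _ = 1%:M) ?mulmx1 ?mulVmx //.
    by apply/matrixP => i j; rewrite !mxE.
  rewrite exprS IH -mulmxE !mulmxA mulmxK //.
  rewrite -[_ *m diag_mx v *m _]mulmxA mulmx_diag; congr (_ *m diag_mx _ *m _).
  by apply/rowP => j; rewrite !mxE exprS.
rewrite mxtrace_mulC mulmxA mulmxV // mul1mx mxtrace_diag.
by apply: eq_bigr => i _; rewrite mxE.
Qed.

Lemma gram_hermsym p d (B : 'M[R[i]]_(p, d)) :
  conj_transpose B *m B \is hermsymmx.
Proof.
apply/is_hermitianmxP; rewrite expr0 scale1r.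
apply/matrixP => i j; rewrite !mxE rmorph_sum; apply: eq_bigr => k _.
rewrite !mxE rmorphM /= mulrC; congr (_ * _).
exact/esym/conjCK.
Qed.

Lemma gram_spectrum p d (B : 'M[R[i]]_(p, d)) :
  exists lam : 'I_d -> R,
    (forall U, esd (conj_transpose B *m B) U =
       ((d%:R^-1)%:E * \sum_i \d_(lam i) U)%E) /\
    (forall k, \tr ((conj_transpose B *m B) ^+ k) = \sum_i ((lam i) ^+ k)%:C).
Proof.
set H := conj_transpose B *m B.
have hH : H \is hermsymmx := gram_hermsym B.
have /orthomx_spectralP := hermitian_normalmx hH.
set P := spectralmx H; set sp := spectral_diag H => HE.
have uP : P \in unitmx by exact: spectral_unit.
have spR i : sp 0 i \is Num.real.
  by have /mxOverP := hermitian_spectral_diag_real hH; apply.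
exists (fun i => complex.Re (sp 0 i)).
have spE i : (complex.Re (sp 0 i))%:C = sp 0 i.
  by have := spR i; move/RRe_real.
split.
- move=> U; rewrite /esd; congr (_ * _)%E.
  (* [eigenvalues] comes from a chosen factorization of the characteristic polynomial, so it matches
     the spectral diagonal only up to order. *)
  have pe : perm_eq (eigenvalues H) [seq sp 0 i | i <- enum 'I_d].
    apply: prod_XsubC_eq; rewrite big_map big_enum /=.
    have -> : \prod_i ('X - (sp 0 i)%:P) = char_poly H.
      rewrite HE char_poly_conj // char_poly_trig ?diag_mx_is_trig //.
      by apply: eq_bigr => i _; rewrite mxE eqxx mulr1n.
    have := svalP (closed_field_poly_normal (char_poly H)).
    rewrite -/(eigenvalues H) => e.
    by rewrite [RHS]e (monicP (char_poly_monic H)) scale1r.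
  by rewrite (perm_big _ pe) big_map big_enum.
- move=> k; rewrite HE trace_conj_diag_exp //.
  by apply: eq_bigr => i _; rewrite -[in LHS]spE rmorphXn.
Qed.

End Spectrum.

(** * Finite sums of point masses and their power sums *)

Section AtomicMeasures.
Variable R : realType.

(** Power sums determine the sum of any polynomial over the values; a polynomial that vanishes at
    all of them except x isolates the multiplicity of x. *)
Lemma perm_of_power_sums n (l l' : 'I_n -> R) :
  (forall k, \sum_i l i ^+ k = \sum_i l' i ^+ k) ->
  perm_eq [seq l i | i <- enum 'I_n] [seq l' i | i <- enum 'I_n].
Proof.
move=> hk; apply/allP => x _; apply/eqP.
set s := [seq l i | i <- _]; set s' := [seq l' i | i <- _].
have hp (q : {poly R}) : \sum_(y <- s) q.[y] = \sum_(y <- s') q.[y].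
  have E (f : 'I_n -> R) :
      \sum_(y <- [seq f i | i <- enum 'I_n]) q.[y] = \sum_i q.[f i].
    by rewrite big_map big_enum.
  rewrite !E.
  under eq_bigr do rewrite horner_coef;
    under [RHS]eq_bigr do rewrite horner_coef.
  rewrite exchange_big [RHS]exchange_big; apply: eq_bigr => k _ /=.
  by rewrite -!mulr_sumr hk.
pose q : {poly R} := \prod_(y <- undup [seq z <- s ++ s' | z != x]) ('X - y%:P).
have q0 y : y \in s ++ s' -> q.[y] = if y == x then q.[x] else 0.
  move=> ys; case: eqVneq => [-> //|yx].
  by apply/eqP; rewrite -/(root q y) root_prod_XsubC mem_undup mem_filter yx.
have qx : q.[x] != 0.
  by rewrite -/(root q x) root_prod_XsubC mem_undup mem_filter eqxx.
have cnt t : {subset t <= s ++ s'} -> \sum_(y <- t) q.[y] = (count_mem x t)%:R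
  * q.[x].
  elim: t => [|y t IH] ht; first by rewrite big_nil mul0r.
  rewrite big_cons IH => [|z zt]; last by apply: ht; rewrite in_cons zt orbT.
  rewrite q0 ?ht ?mem_head //= natrD mulrDl; congr (_ + _).
  by case: eqP; rewrite ?mul1r ?mul0r.
have := hp q; rewrite !cnt; last 2 first.
- by move=> z zs; rewrite mem_cat zs orbT.
- by move=> z zs; rewrite mem_cat zs.
by move/(mulIf qx)/eqP; rewrite eqr_nat => /eqP.
Qed.

Lemma dirac_sum_eqP n (l l' : 'I_n -> R) :
  (forall U : set R, measurable U ->
     (\sum_i \d_(l i) U = \sum_i \d_(l' i) U :> \bar R)%E) <->
  (forall k, \sum_i l i ^+ k = \sum_i l' i ^+ k).
Proof.
split=> [hU k|/perm_of_power_sums pe U _]; last first.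
  have E (f : 'I_n -> R) : (\sum_i \d_(f i) U =
      \sum_(y <- [seq f i | i <- enum 'I_n]) \d_y U :> \bar R)%E.
    by rewrite big_map big_enum.
  by rewrite !E (perm_big _ pe).
suff pe : perm_eq [seq l i | i <- enum 'I_n] [seq l' i | i <- enum 'I_n].
  have E (f : 'I_n -> R) : \sum_i f i ^+ k =
      \sum_(y <- [seq f i | i <- enum 'I_n]) y ^+ k.
    by rewrite big_map big_enum.
  by rewrite !E (perm_big _ pe).
apply/allP => x _; apply/eqP.
have cnt (f : 'I_n -> R) : (\sum_i \d_(f i) [set x] =
    ((count_mem x [seq f i | i <- enum 'I_n])%:R)%:E :> \bar R)%E.
  transitivity (\sum_(y <- [seq f i | i <- enum 'I_n]) \d_y [set x] : \bar R)%E.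
    by rewrite big_map big_enum.
  elim: [seq _ | _ <- _] => [|y s IH]; first by rewrite big_nil.
  rewrite big_cons IH /= diracE natrD EFinD; congr (_ + _)%E.
  congr (_%:R)%:E; congr nat_of_bool.
  by apply/idP/eqP; rewrite inE.
have := hU [set x] (measurable_set1 x).
by rewrite !cnt => -[] /eqP; rewrite eqr_nat => /eqP.
Qed.

End AtomicMeasures.

(** * Identifiability *)

Section MomentFlowOfFamily.
Variables (R : realType) (A : cstarAlgType R) (tau : {scalar A}).
Hypothesis htau : faithful_tracial_state tau.
Variables (p d : nat) (C : 'M[A]_(p, d)).
Hypothesis d_gt0 : (0 < d)%N.
Hypothesis hC : star_free_circular tau (fun ij : 'I_p * 'I_d => C ij.1 ij.2).
Hypothesis hC1 : forall i j, tau (star (C i j) * C i j) = d%:R^-1.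
Variable B : 'M[R[i]]_(p, d).

Local Notation lam := (p%:R / d%:R : R[i]).
Local Notation moment := (moment tau C B).
Local Notation comoment := (comoment tau C B).

(** The moment equation is available only at real s; the naturals already supply infinitely many
    points. *)
Lemma poly_eq_nat (q q' : {poly R[i]}) :
  (forall n : nat, q.[n%:R] = q'.[n%:R]) -> q = q'.
Proof.
move=> e; apply/eqP; rewrite -subr_eq0; apply/negPn/negP => nz.
have := @max_poly_roots _ (q - q') [seq k%:R | k <- iota 0 (size (q - q'))] nz.
rewrite size_map size_iota ltnn => h; suff: false by []; apply: h.
  by apply/allP => _ /mapP[k _ ->]; rewrite /root hornerD hornerN e subrr.
rewrite map_inj_uniq ?iota_uniq // => m n /eqP.
by rewrite eqr_nat => /eqP.
Qed.

Lemma moment_poly_flow k : (moment_poly tau C B k)^`() =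
  (2%:P * 'X) * flow_field lam (moment_poly tau C B) k.
Proof.
apply: poly_eq_nat => n; rewrite -(rmorph_nat (real_complex R)) /=.
rewrite (horner_deriv_moment_poly htau d_gt0 hC hC1 B).
rewrite !hornerM hornerC hornerX /flow_field hornerZ horner_sum.
congr (_ * (_ * _)); apply: eq_bigr => a _; rewrite hornerM.
rewrite [in RHS]horner_moment_poly /comoment; congr (_ * _).
by case: ifP => _; rewrite ?hornerC ?horner_moment_poly.
Qed.

Lemma moment_flow : exists2 G : nat -> {poly R[i]},
  forall k s, (G k).[(s ^+ 2)%:C] = moment s k &
  forall k, (G k)^`() = flow_field lam G k.
Proof.
have [H MH dH] := flow_sqrt moment_poly_flow.
exists H => // k s; rewrite -horner_moment_poly MH horner_comp hornerXn.
by rewrite rmorphXn.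
Qed.

Lemma moment_at0 k :
  moment 0 k = d%:R^-1 * \tr ((conj_transpose B *m B) ^+ k).
Proof.
rewrite /moment mxstateE; congr (_ * _).
have WE : W_SPN C B 0 = map_mx (in_alg A) (conj_transpose B *m B).
  rewrite map_mxM W_SPN_E; congr (_ *m _); apply/matrixP => i j; rewrite !mxE.
    by rewrite scale0r addr0 star_alg.
  by rewrite scale0r addr0.
have -> : W_SPN C B 0 ^+ k = map_mx (in_alg A) ((conj_transpose B *m B) ^+ k).
  elim: k => [|k IH].
    by apply/matrixP => i j; rewrite !expr0 !mxE rmorph_nat.
  rewrite !exprS IH WE -!mulmxE; move: (_ *m B) => H.
  by rewrite map_mxM.
apply: eq_bigr => i _; rewrite [X in tau X]mxE linearZ /= (state1 htau).
by rewrite mulr1.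
Qed.

End MomentFlowOfFamily.

(** * Absence of polynomial relations for nonzero noise *)

Section Rigidity.
Variables (R : realType) (A : cstarAlgType R) (tau : {scalar A}).
Hypothesis htau : faithful_tracial_state tau.
Variables (p d : nat) (C : 'M[A]_(p, d)).
Hypothesis d_gt0 : (0 < d)%N.
Hypothesis p_gt0 : (0 < p)%N.
Hypothesis hC : star_free_circular tau (fun ij : 'I_p * 'I_d => C ij.1 ij.2).
Hypothesis hC0 : forall i j, tau (C i j) = 0.
Hypothesis hC1 : forall i j, tau (star (C i j) * C i j) = d%:R^-1.
Variables (B : 'M[R[i]]_(p, d)) (s : R).
Hypothesis s_neq0 : s != 0.

Local Notation X := (X_SPN C B s).
Local Notation W := (W_SPN C B s).
Local Notation m := (moment tau C B s).
Local Notation com := (comoment tau C B s).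

Lemma mxtau_gram_eq0 n k (M : 'M[A]_(n, k)) :
  mxtau tau (mxstar M *m M) = 0 -> M = 0.
Proof.
have ge0 i j : 0 <= tau (star (M i j) * M i j) by exact: state_ge0.
rewrite /mxtau => h0.
have {}h0 : \sum_j \sum_i tau (star (M i j) * M i j) = 0.
  rewrite -[RHS]h0; apply: eq_bigr => j _; rewrite mxE linear_sum.
  by apply: eq_bigr => i _; rewrite mxE.
apply/matrixP => i j; rewrite mxE; apply: (state_faithful htau).
have h1 : \sum_i tau (star (M i j) * M i j) = 0.
  apply: (psumr_eq0P _ h0) => // j' _; exact: sumr_ge0.
by apply: (psumr_eq0P _ h1).
Qed.

(** Otherwise X = 0 by faithfulness. Applying tau to an entry kills the entry of B, as C is
    centered, and then the entry of C is zero, against its variance 1/d. *)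
Lemma moment1_neq0 : m 1 != 0.
Proof.
apply/eqP; rewrite /moment expr1 W_SPN_E mxstateE => /eqP.
rewrite mulf_eq0 invr_eq0 pnatr_eq0 eqn0Ngt d_gt0 /= => /eqP /mxtau_gram_eq0 X0.
pose i0 := Ordinal p_gt0; pose j0 := Ordinal d_gt0.
have := congr1 (fun M : 'M[A]_(p, d) => M i0 j0) X0; rewrite !mxE => h.
have b0 : B i0 j0 = 0.
  have := congr1 tau h; rewrite linearD !linearZ /= (state1 htau) hC0 mulr0.
  by rewrite addr0 mulr1 linear0.
move: h; rewrite b0 scale0r add0r => h.
have c0 : C i0 j0 = 0.
  have s0 : (s%:C : R[i]) != 0 by rewrite eq_complex /= eqxx andbT.
  by rewrite -[LHS](scalerK s0) h scaler0.
have := hC1 i0 j0; rewrite c0 mulr0 linear0 => /eqP.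
by rewrite eq_sym invr_eq0 pnatr_eq0 eqn0Ngt d_gt0.
Qed.

Definition mxcomb n (c : nat -> R[i]) : 'M[A]_d :=
  \matrix_(i, j) \sum_(k < n) c k *: (W ^+ k) i j.

Lemma mxtau_mxcomb n c (N : 'M[A]_d) :
  mxtau tau (N *m mxcomb n c) = \sum_(k < n) c k * mxtau tau (N *m W ^+ k).
Proof.
under [RHS]eq_bigr do rewrite mulr_sumr; rewrite exchange_big.
apply: eq_bigr => i _ /=.
rewrite mxE linear_sum /=.
under [RHS]eq_bigr do rewrite mxE linear_sum /= mulr_sumr.
rewrite exchange_big; apply: eq_bigr => j _ /=.
rewrite mxE mulr_sumr linear_sum; apply: eq_bigr => k _.
by rewrite -scalerAr linearZ.
Qed.

(** The hypothesis makes the combination orthogonal to every power of W, hence to itself;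
    faithfulness concludes. *)
Lemma mxcomb_eq0 n (c : nat -> R[i]) : (forall j, \sum_(k < n) c k * m (j +
  k)%N = 0) ->
  mxcomb n c = 0.
Proof.
move=> hc; apply: mxtau_gram_eq0.
have h k : mxtau tau (W ^+ k *m mxcomb n c) = 0.
  transitivity (d%:R * \sum_(l < n) c l * m (k + l)%N); last first.
    by rewrite hc mulr0.
  rewrite mxtau_mxcomb mulr_sumr.
  apply: eq_bigr => l _; rewrite mulmxE -exprD mxtauE //.
  by rewrite mulrCA.
have -> : mxstar (mxcomb n c) = mxcomb n (fun k => ((c k)^*)%C).
  apply/matrixP => i j; rewrite !mxE star_sum; apply: eq_bigr => k _.
  by rewrite starZ -[in RHS]mxstar_W // mxE.
rewrite (mxtau_mulC htau) mxtau_mxcomb big1 // => k _.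
by rewrite (mxtau_mulC htau) h mulr0.
Qed.

(* Feeding W^j V(W) = 0 into the Schwinger-Dyson equation. *)
Lemma stein_mxcomb n (c : nat -> R[i]) j : mxcomb n c = 0 ->
  \sum_(k < n) c k * \sum_(a < (j + k).+1) com (j + k - a)%N * m a = 0.
Proof.
move=> V0; have s0 : (s%:C : R[i]) != 0 by rewrite eq_complex /= eqxx andbT.
apply: (mulfI s0); rewrite mulr0 mulr_sumr.
transitivity (\sum_(k < n) c k * (d%:R^-1 *
    mxtau tau (C *m (W ^+ (j + k) *m mxstar X)))).
  by apply: eq_bigr => k _; rewrite (moment_stein htau d_gt0 hC hC1 B s) mulrCA.
transitivity (d%:R^-1 * \sum_(k < n) c k *
    mxtau tau (mxstar X *m C *m W ^+ j *m W ^+ k)).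
  rewrite mulr_sumr; apply: eq_bigr => k _; rewrite mulrCA; congr (_ * (_ * _)).
  by rewrite mulmxA (mxtau_mulC htau) exprD -mulmxE !mulmxA.
by rewrite -mxtau_mxcomb V0 mulmx0 /mxtau big1 ?mulr0 // => i _;
  rewrite mxE linear0.
Qed.

(** Induction on the degree. In [stein_mxcomb] the terms with a < j, and those carrying p/d, are
    multiples of instances of the relation itself; what remains is a relation of degree one less. In
    degree 0, m_0 = 1 gives the contradiction. *)
Lemma no_moment_relation n (c : nat -> R[i]) : c n != 0 ->
  ~ (forall j, \sum_(k < n.+1) c k * m (j + k)%N = 0).
Proof.
elim: n c => [|n IH] c cn hc.
  have := hc 0%N; rewrite big_ord1 addn0 /moment expr0 mxstateE.
  have -> : mxtau tau (1 : 'M[A]_d) = d%:R.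
    rewrite /mxtau; under eq_bigr do rewrite mxE eqxx (state1 htau).
    by rewrite sumr_const card_ord.
  by rewrite mulVf ?pnatr_eq0 -?lt0n // mulr1 => /eqP; rewrite (negPf cn).
(* With V the polynomial of coefficients [c], these are the coefficients of Y (V(X) - V(Y))/(X - Y)
   after Y^l is replaced by m_l. The leading one is [c n.+1 * m 1]. *)
pose c' a := \sum_(k < n.+2 | (a < k)%N) c k * m (k - a)%N.
apply: (IH c').
  rewrite /c' (big_pred1 ord_max) => [|k]; last first.
    rewrite /= -val_eqE /= eqn_leq -ltnS.
    by rewrite -[(k <= n.+1)%N]ltnS ltn_ord.
  by rewrite /= subSnn mulf_neq0 // moment1_neq0.
move=> j; have := stein_mxcomb j (mxcomb_eq0 hc).
have -> : \sum_(k < n.+2) c k * \sum_(a < (j + k).+1) com (j + k - a)%N * m a =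
    \sum_(k < n.+2) c k * \sum_(a < j) m (j + k - a)%N * m a +
    \sum_(k < n.+2) c k * \sum_(a < k.+1) com (k - a)%N * m (j + a)%N.
  rewrite -big_split; apply: eq_bigr => k _; rewrite /= -mulrDr; congr (_ * _).
  rewrite -addnS big_split_ord /=; congr (_ + _).
    apply: eq_bigr => a _; rewrite /comoment subn_eq0 leqNgt.
    by rewrite (leq_trans (ltn_ord a)) ?leq_addr.
  by apply: eq_bigr => a _; rewrite subnDl.
have -> : \sum_(k < n.+2) c k * \sum_(a < j) m (j + k - a)%N * m a = 0.
  under eq_bigr do rewrite mulr_sumr.
  rewrite exchange_big big1 // => a _ /=.
  transitivity ((\sum_(k < n.+2) c k * m (j - a + k)%N) * m a); last first.
    by rewrite hc mul0r.
  rewrite mulr_suml.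
  apply: eq_bigr => k _; rewrite mulrA; congr (_ * m _ * _).
  by rewrite addnBAC // ltnW.
rewrite add0r => h; apply: etrans h.
have -> : \sum_(k < n.+2) c k * \sum_(a < k.+1) com (k - a)%N * m (j + a)%N =
   \sum_(k < n.+2) c k * \sum_(a < k) m (k - a)%N * m (j + a)%N +
   com 0%N * \sum_(k < n.+2) c k * m (j + k)%N.
  rewrite mulr_sumr -big_split; apply: eq_bigr => k _ /=.
  rewrite big_ord_recr /= subnn mulrDr mulrCA; congr (_ * _ + _).
  apply: eq_bigr => a _; rewrite /comoment subn_eq0 leqNgt ltn_ord //.
rewrite hc mulr0 addr0 /c'.
under eq_bigr do rewrite mulr_suml.
rewrite (exchange_big_dep xpredT) //=; apply: eq_bigr => k _.
rewrite mulr_sumr.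
rewrite (big_ord_widen_cond n.+1 xpredT (fun a => c k * (m (k - a)%N * m (j +
  a)%N))).
  by apply: eq_bigr => a _; rewrite mulrA.
by rewrite -ltnS.
Qed.

End Rigidity.

Lemma esd_gram_eqP (R : realType) (p d : nat) (d_gt0 : (0 < d)%N)
  (A B : 'M[R[i]]_(p, d)) :
  (forall U : set R, measurable U ->
      esd (conj_transpose A *m A) U = esd (conj_transpose B *m B) U) <->
  (forall k, \tr ((conj_transpose A *m A) ^+ k) =
             \tr ((conj_transpose B *m B) ^+ k)).
Proof.
have [l [lE lk]] := gram_spectrum A; have [l' [lE' lk']] := gram_spectrum B.
have d0 : (d%:R : R) != 0 by rewrite pnatr_eq0 -lt0n.
have trE : (forall k, \tr ((conj_transpose A *m A) ^+ k) =
    \tr ((conj_transpose B *m B) ^+ k)) <->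
    (forall k, \sum_i l i ^+ k = \sum_i l' i ^+ k).
  split=> h k; last by rewrite lk lk' -!(rmorph_sum (real_complex R)) h.
  by have := h k; rewrite lk lk' -!(rmorph_sum (real_complex R)) => -[].
rewrite trE -dirac_sum_eqP; split=> h U mU; last by rewrite lE lE' h.
have := h U mU; rewrite lE lE' => /(congr1 (fun x => (d%:R)%:E * x)%E).
by rewrite !muleA -!EFinM mulfV // !mul1e.
Qed.

Lemma is_distribution_unique (R : realType) (T : pzRingType) (phi : T -> R[i])
  (a b : T) (mu nu : probability (measurableTypeR R) R) :
  is_distribution phi a mu -> is_distribution phi b nu ->
  (forall U : set R, measurable U -> mu U = nu U) <->
  (forall k, phi (a ^+ k) = phi (b ^+ k)).
Proof.
move=> [[M hM] ha] [[N hN] hb]; split=> [e k|e].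
  rewrite ha hb /Rintegral; congr ((fine _)%:C).
  by apply: eq_measure_integral => U mU _; exact: e.
apply: (moment_determinacy hM hN) => k.
by have := e k; rewrite ha hb => -[].
Qed.

(** * Recovering the noise level and the Gram traces *)

Section MomentIdentifiability.
Variables (R : realType) (AA : cstarAlgType R) (tau : {scalar AA}).
Hypothesis htau : faithful_tracial_state tau.
Variables (p d : nat) (C : 'M[AA]_(p, d)).
Hypothesis d_gt0 : (0 < d)%N.
Hypothesis p_gt0 : (0 < p)%N.
Hypothesis hC : star_free_circular tau (fun ij : 'I_p * 'I_d => C ij.1 ij.2).
Hypothesis hC0 : forall i j, tau (C i j) = 0.
Hypothesis hC1 : forall i j, tau (star (C i j) * C i j) = d%:R^-1.

(* A relation between the moments is obtained from the polynomial vanishing on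
   the spectrum of B^* B. *)
Lemma moment_atomic (A B : 'M[R[i]]_(p, d)) (s : R) :
  (forall k, moment tau C A s k = moment tau C B 0 k) -> s = 0.
Proof.
move=> h; apply/eqP/negPn/negP => s0.
have [l [_ lk]] := gram_spectrum B.
pose P : {poly R[i]} := \prod_(i < d) ('X - ((l i)%:C)%:P).
have sP : size P = d.+1 by rewrite /P size_prod_XsubC /index_enum -enumT
  size_enum_ord.
have Pd : P`_d != 0.
  have := monicP (monic_prod_XsubC (index_enum 'I_d) xpredT (fun i => (l
    i)%:C)).
  by rewrite -/P lead_coefE sP /= => ->; exact: oner_neq0.
apply: (no_moment_relation htau d_gt0 p_gt0 hC hC0 hC1 (B := A) s0 Pd) => j.
have -> : \sum_(k < d.+1) P`_k * moment tau C A s (j + k)%N =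
    d%:R^-1 * \sum_i (l i)%:C ^+ j * P.[(l i)%:C].
  under eq_bigr do rewrite h (moment_at0 htau) lk mulrCA mulr_sumr.
  rewrite -mulr_sumr exchange_big; congr (_ * _); apply: eq_bigr => i _ /=.
  rewrite horner_coef sP mulr_sumr; apply: eq_bigr => k _.
  by rewrite rmorphXn /= exprD mulrCA.
rewrite big1 ?mulr0 // => i _.
rewrite /P (bigD1 i) //= hornerM hornerXsubC subrr mul0r mulr0 //.
Qed.

Lemma moment_sqr_le (A B : 'M[R[i]]_(p, d)) (sigma rho : R) :
  rho ^+ 2 <= sigma ^+ 2 ->
  (forall k, moment tau C A sigma k = moment tau C B rho k) ->
  sigma ^+ 2 = rho ^+ 2.
Proof.
move=> le h; pose s := Num.sqrt (sigma ^+ 2 - rho ^+ 2).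
have s2 : s ^+ 2 = sigma ^+ 2 - rho ^+ 2 by rewrite sqr_sqrtr // subr_ge0.
have [G GA dG] := moment_flow htau d_gt0 hC hC1 A.
have [H HB dH] := moment_flow htau d_gt0 hC hC1 B.
pose c : R[i] := (s ^+ 2)%:C.
(* The flow of A advanced by s^2 agrees with that of B at time rho^2, hence identically; time 0 then
   compares [W_SPN C A s] with B^* B. *)
have GH : (fun k => G k \Po ('X + c%:P)) =1 H.
  apply: (@flow_unique _ (p%:R / d%:R) 1 _ _ (rho ^+ 2)%:C) => k.
  - by rewrite mul1r; exact: flow_shift.
  - by rewrite mul1r.
  - rewrite horner_comp !hornerE -rmorphD s2 /= addrC subrK.
    by rewrite GA HB.
suff : s = 0 by move=> s0; apply/eqP; rewrite -subr_eq0 -s2 s0 expr0n.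
apply: (@moment_atomic A B) => k.
by rewrite -GA -HB expr0n /= -GH horner_comp !hornerE.
Qed.

(** Once the times agree, uniqueness of the flow carries agreement from time sigma^2 to time 0 and
    back, and at time 0 the moments are the normalized Gram traces. *)
Lemma moment_identifiability (A B : 'M[R[i]]_(p, d)) (sigma rho : R) :
  (forall k, moment tau C A sigma k = moment tau C B rho k) <->
  ((forall k, \tr ((conj_transpose A *m A) ^+ k) =
              \tr ((conj_transpose B *m B) ^+ k)) /\ sigma ^+ 2 = rho ^+ 2).
Proof.
have d0 : (d%:R : R[i])^-1 != 0 by rewrite invr_eq0 pnatr_eq0 -lt0n.
have [G GA dG] := moment_flow htau d_gt0 hC hC1 A.
have [H HB dH] := moment_flow htau d_gt0 hC hC1 B.
have GH t : (forall k, (G k).[t] = (H k).[t]) -> G =1 H.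
  by apply: (@flow_unique _ (p%:R / d%:R) 1) => k; rewrite mul1r.
split=> [h|[h e] k].
  have e : sigma ^+ 2 = rho ^+ 2.
    case: (leP (rho ^+ 2) (sigma ^+ 2)) => [le|/ltW le].
      exact: moment_sqr_le le h.
    by apply/esym; apply: (moment_sqr_le (A := B) (B := A) le) => k.
  split=> // k; apply: (mulfI d0); rewrite -!(moment_at0 htau C) -GA -HB.
  by rewrite (GH (sigma ^+ 2)%:C) // => l; rewrite GA h e HB.
rewrite -GA -HB e (GH 0) // => l.
have := GA l 0; have := HB l 0; rewrite expr0n /= => -> ->.
by rewrite !(moment_at0 htau) h.
Qed.

End MomentIdentifiability.

Theorem theorem1p1 (R : realType) (AA : cstarAlgType R) (tau : {scalar AA})
  (htau : faithful_tracial_state tau)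
  (p d : nat) (hd : (0 < d)%N) (hpd : (d <= p)%N)
  (C : 'M[AA]_(p, d))
  (hC : star_free_circular tau (fun ij : 'I_p * 'I_d => C ij.1 ij.2))
  (hC0 : forall i j, tau (C i j) = 0)
  (hC1 : forall i j, tau (star (C i j) * C i j) = d%:R^-1)
  (A B : 'M[R[i]]_(p, d)) (sigma rho : R)
  (muA muB : probability (measurableTypeR R) R)
  (hmuA : is_mu_SPN tau C A sigma muA)
  (hmuB : is_mu_SPN tau C B rho muB) :
  (forall U : set R, measurable U -> muA U = muB U) <->
  ((forall U : set R, measurable U ->
      esd (conj_transpose A *m A) U = esd (conj_transpose B *m B) U) /\
   sigma ^+ 2 = rho ^+ 2).
Proof.
rewrite (is_distribution_unique hmuA hmuB) (esd_gram_eqP hd).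
exact: (moment_identifiability htau hd (leq_trans hd hpd) hC hC0 hC1).
Qed.
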